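(* Let $\Gamma\subset\mathbb{M}_{m,n}$ be an orthogonally invariant matrix set, represented as $\Gamma=\{X\in\mathbb{M}_{m,n}:\sigma(X)\in\Delta\}$ with $\Delta=\{x\in\mathbb{R}^n:\mathrm{diag}(x)\in\Gamma\}$. Let $X\in\Gamma$ and $H\in T_\Gamma(X)$. Then $$T^2_\Gamma(X,H)=\{W\in\mathbb{M}_{m,n}:\ \sigma''(X;H,W)\in T^2_\Delta(\sigma(X),\sigma'(X;H))\}.$$ Moreover, if $\Delta$ is parabolically derivable at $\sigma(X)$ for $\sigma'(X;H)$, then $\Gamma$ is parabolically derivable at $X$ for $H$.
   Context: Throughout, $m,n$ are natural numbers with $n\le m$; $\mathbb{M}_{m,n}$ is the space of real $m\times n$ matrices with the Frobenius norm; $\mathrm{diag}(x)$ is the $m\times n$ diagonal matrix with diagonal $x$; $\sigma(X)$ is the vector of singular values of $X$ in nonincreasing order. $\sigma'(X;H)=\lim_{t\downarrow0}(\sigma(X+tH)-\sigma(X))/t$ and $\sigma''(X;H,W)=\lim_{t\downarrow0}\frac{\sigma(X+tH+\frac12t^2W)-\sigma(X)-t\sigma'(X;H)}{\frac12t^2}$ (componentwise; both limits always exist). $\Gamma\subset\mathbb{M}_{m,n}$ is orthogonally invariant if $X\in\Gamma$ implies $U^TXV\in\Gamma$ for all orthogonal $U$ ($m\times m$), $V$ ($n\times n$); then $\Delta$ is absolutely symmetric, i.e. invariant under all signed permutation matrices. For a subset $C$ of a Euclidean space and $\bar x\in C$: the tangent cone is $T_C(\bar x)=\{w:\exists t_k\downarrow0,\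 w_k\to w,\ \bar x+t_kw_k\in C\}$; for $w\in T_C(\bar x)$ the second-order tangent set is $T^2_C(\bar x,w)=\{u:\exists t_k\downarrow0,\ u_k\to u,\ \bar x+t_kw+\frac12t_k^2u_k\in C\}$. $C$ is parabolically derivable at $\bar x$ for $w$ if $T^2_C(\bar x,w)\ne\emptyset$ and for each $u\in T_C^2(\bar x,w)$ there are $\epsilon>0$ and an arc $\xi\colon[0,\epsilon]\to C$ with $\xi(0)=\bar x$, $\xi'_+(0)=w$, $\xi''_+(0)=u$, where $\xi''_+(0)=\lim_{t\downarrow0}[\xi(t)-\xi(0)-t\xi'_+(0)]/(\frac12t^2)$. *)

(* Defs.v *)
From mathcomp Require Import all_boot all_order all_algebra.
From mathcomp Require Import all_classical all_reals all_analysis.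

Set Implicit Arguments.
Unset Strict Implicit.
Unset Printing Implicit Defensive.

Import Order.TTheory GRing.Theory Num.Theory.
Import numFieldNormedType.Exports.
Local Open Scope classical_set_scope.
Local Open Scope ring_scope.

(* Limits in 'M[R]_(m, n) are taken in the library's (sup-norm) topology; it is
   the topology of the Frobenius norm, all norms on this finite-dimensional
   space being equivalent. *)

Section VariationalGeometry.
Context {R : realType} {V : normedModType R}.
Implicit Types (C : set V) (x w : V).

(* "t_k decreases to 0" is read as usual in variational analysis: t_k > 0 and
   t_k --> 0. *)
Definition tangent_cone C x : set V :=
  [set w | exists (t : nat -> R) (w_ : nat -> V),
    [/\ forall k, 0 < t k, t k @[k --> \oo] --> (0 : R),
        w_ k @[k --> \oo] --> w
      & forall k, C (x + t k *: w_ k)]].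

Definition second_order_tangent_set C x w : set V :=
  [set u | exists (t : nat -> R) (u_ : nat -> V),
    [/\ forall k, 0 < t k, t k @[k --> \oo] --> (0 : R),
        u_ k @[k --> \oo] --> u
      & forall k, C (x + t k *: w + (2^-1 * t k ^+ 2) *: u_ k)]].

(* The arc [0, eps] -> C is a total function on R of which only the restriction
   to [0, eps] matters; the limits are right limits at 0. *)
Definition parabolically_derivable C x w : Prop :=
  second_order_tangent_set C x w !=set0 /\
  forall u, second_order_tangent_set C x w u ->
    exists (eps : R) (xi : R -> V),
      [/\ 0 < eps,
          forall t : R, 0 <= t <= eps -> C (xi t),
          xi 0 = x,
          t^-1 *: (xi t - xi 0) @[t --> 0^'+] --> w
        & (2^-1 * t ^+ 2)^-1 *: (xi t - xi 0 - t *: w) @[t --> 0^'+] --> u].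

End VariationalGeometry.

Section SingularValues.
Context {R : realType} {m n : nat}.
Implicit Types (X H W : 'M[R]_(m, n)) (s x : 'rV[R]_n).

(* The s_i are the nonnegative square roots of the eigenvalues of X^T X,
   counted with multiplicity and listed in nonincreasing order.  For n <= m
   these are the n singular values of X. *)
Definition is_singular_values X s : Prop :=
  [/\ forall i, 0 <= s 0 i,
      forall i j : 'I_n, (i <= j)%N -> s 0 j <= s 0 i
    & char_poly (X^T *m X) = \prod_(i < n) ('X - (s 0 i ^+ 2)%:P)].

(* is_singular_values X holds of exactly one vector, so the default value 0 is
   never used. *)
Definition sigma X : 'rV[R]_n := xget 0 [set s | is_singular_values X s].

Definition sigma' X H : 'rV[R]_n :=
  \row_i lim ((sigma (X + t *: H) 0 i - sigma X 0 i) / t @[t --> 0^'+]).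

Definition sigma'' X H W : 'rV[R]_n :=
  \row_i lim ((sigma (X + t *: H + (2^-1 * t ^+ 2) *: W) 0 i - sigma X 0 i
                 - t * sigma' X H 0 i) / (2^-1 * t ^+ 2) @[t --> 0^'+]).

Definition rect_diag_mx x : 'M[R]_(m, n) :=
  \matrix_(i < m, j < n) (if i == j :> nat then x 0 j else 0).

Definition orthogonally_invariant (Gamma : set 'M[R]_(m, n)) : Prop :=
  forall X (U : 'M[R]_m) (V : 'M[R]_n),
    U^T *m U = 1%:M -> V^T *m V = 1%:M -> Gamma X -> Gamma (U^T *m X *m V).

Definition diag_set (Gamma : set 'M[R]_(m, n)) : set 'rV[R]_n :=
  [set x | Gamma (rect_diag_mx x)].

End SingularValues.

(* Main.v *)
Require Import Defs.
From mathcomp Require Import all_boot all_order all_algebra.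
From mathcomp Require Import fingroup perm.
From mathcomp Require complex.
From mathcomp Require Import all_classical all_reals all_analysis.
From mathcomp Require Import ring lra.

Set Implicit Arguments.
Unset Strict Implicit.
Unset Printing Implicit Defensive.

Import Order.TTheory GRing.Theory Num.Theory.
Import numFieldNormedType.Exports.
Local Open Scope classical_set_scope.
Local Open Scope ring_scope.

(**
The two ingredients are the singular value decomposition and a parabolic
second-order expansion of the singular values.

Expansion. For fixed X, H and every W,
  sigma(X + t H + t^2/2 W) = sigma(X) + t sigma'(X;H) + t^2/2 sigma''(X;H,W) + o(t^2)
as t decreases to 0 ([sigma_second_derivative]), and sigma is Lipschitz
([sigma_lipschitz]), so that W may be replaced by W_k --> W along a sequence.
Both facts are proved for the sorted eigenvalues of symmetric matrices and are
transferred to singular values through the symmetric matrix with blocks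
0, X^T, X, 0, whose largest n eigenvalues are the singular values of X.
- The Lipschitz bound is Weyl's inequality ([spectrum_lipschitz]).
- Along a line A + t B the sorted eigenvalues are affine up to O(t^2)
  ([spectrum_line]).  Conjugating by the Cayley transform of a small skew
  matrix removes from B, at the cost of O(t^2), the part that does not commute
  with A; what is left is diagonalized together with A, so its eigenvalues are
  affine in t, and for small t > 0 they stay in lexicographic order.
- Hence the second-order quotient along A + t B + t^2/2 C is bounded.  Its limit
  exists because it has no room to oscillate: for all but finitely many levels
  c, the characteristic polynomial evaluated along a + b t + c t^2/2 is a
  nonzero polynomial in t, so near 0 the eigenvalue does not meet that parabola
  and, being continuous, stays on one side of it ([spectrum_parabola_cvg]).

Tangent sets.  If X + t_k H + t_k^2/2 W_k lies in Gamma, its singular values lie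
in Delta and the expansion gives sigma''(X;H,W) as a second-order tangent
([second_order_tangent_sigma]).  Conversely, write Z = U^T diag(sigma(Z)) V;
replacing sigma(Z) by a point y of Delta yields a point of Gamma whose distance
to Z is at most a constant times |y - sigma(Z)| ([spectral_lift]).  Applied to
Z = X + t H + t^2/2 W this turns sequences, or arcs, of Delta that are
o(t^2)-close to sigma(Z) into sequences, or arcs, of Gamma that are o(t^2)-close
to Z.  This gives the other inclusion ([second_order_tangent_lift]) and the arcs
([parabolic_arc_lift]).  Finally, if the second-order tangent set of Delta is
nonempty, lifting a sequence that realizes one of its points over X + t H gives
second-order quotients which are merely bounded, and any of their cluster points
is a second-order tangent to Gamma ([second_order_tangent_nonempty]).
*)

(** * Orthogonal matrices and common eigenvectors *)

Lemma trmxD (R : pzRingType) m n (A B : 'M[R]_(m, n)) : (A + B)^T = A^T + B^T.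
Proof. exact: linearD. Qed.

Lemma trmxB (R : pzRingType) m n (A B : 'M[R]_(m, n)) : (A - B)^T = A^T - B^T.
Proof. exact: linearB. Qed.

Lemma trmxZ (R : pzRingType) m n c (A : 'M[R]_(m, n)) : (c *: A)^T = c *: A^T.
Proof. by apply/matrixP => i j; rewrite !mxE. Qed.

Section Orthogonal.
Variable R : realType.

Definition orthogonal_mx n (Q : 'M[R]_n) := Q *m Q^T = 1%:M.

Lemma orthogonal_mx_tr n (Q : 'M[R]_n) : orthogonal_mx Q -> orthogonal_mx Q^T.
Proof. by move=> Qo; rewrite /orthogonal_mx trmxK; apply: mulmx1C. Qed.

Lemma orthogonal_mx1 n : orthogonal_mx (1%:M : 'M[R]_n).
Proof. by rewrite /orthogonal_mx trmx1 mulmx1. Qed.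

Lemma orthogonal_mxM n (P Q : 'M[R]_n) :
  orthogonal_mx P -> orthogonal_mx Q -> orthogonal_mx (P *m Q).
Proof.
rewrite /orthogonal_mx => Po Qo.
by rewrite trmx_mul mulmxA -(mulmxA P) Qo mulmx1.
Qed.

Lemma orthogonal_block n (Q : 'M[R]_n) :
  orthogonal_mx Q -> orthogonal_mx (block_mx (1%:M : 'M[R]_1) 0 0 Q).
Proof.
rewrite /orthogonal_mx => Qo; rewrite tr_block_mx mulmx_block trmx1 !trmx0 Qo.
by rewrite !(mulmx0, mul0mx, mulmx1, addr0, add0r) -scalar_mx_block.
Qed.

Lemma orthogonal_perm n (s : 'S_n) : orthogonal_mx (perm_mx s : 'M[R]_n).
Proof. by rewrite /orthogonal_mx tr_perm_mx -perm_mxM mulgV perm_mx1. Qed.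

Definition sqnorm n (v : 'rV[R]_n) : R := (v *m v^T) 0 0.

Lemma sqnormE n (v : 'rV[R]_n) : sqnorm v = \sum_i v 0 i ^+ 2.
Proof. by rewrite /sqnorm mxE; apply: eq_bigr => i _; rewrite mxE expr2. Qed.

Lemma sqnorm_ge0 n (v : 'rV[R]_n) : 0 <= sqnorm v.
Proof. by rewrite sqnormE sumr_ge0 // => i _; rewrite sqr_ge0. Qed.

Lemma sqnorm_eq0 n (v : 'rV[R]_n) : (sqnorm v == 0) = (v == 0).
Proof.
apply/idP/eqP => [|->]; last by rewrite /sqnorm mul0mx mxE.
rewrite sqnormE psumr_eq0 => [/allP h|i _]; last by rewrite sqr_ge0.
apply/rowP => i; have := h i (mem_index_enum i).
by rewrite mxE /= expf_eq0 => /eqP.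
Qed.

Lemma sqnorm_gt0 n (v : 'rV[R]_n) : (0 < sqnorm v) = (v != 0).
Proof. by rewrite lt_def sqnorm_ge0 andbT sqnorm_eq0. Qed.

Lemma mul_row_tr n (v : 'rV[R]_n) : v *m v^T = (sqnorm v)%:M.
Proof. by rewrite [LHS]mx11_scalar. Qed.

Lemma sqnormZ n (a : R) (v : 'rV[R]_n) : sqnorm (a *: v) = a ^+ 2 * sqnorm v.
Proof. by rewrite /sqnorm trmxZ -scalemxAl -scalemxAr !mxE mulrA expr2. Qed.

Lemma sqnormM_orthogonal n (Q : 'M[R]_n) (v : 'rV[R]_n) :
  orthogonal_mx Q -> sqnorm (v *m Q) = sqnorm v.
Proof.
by move=> Qo; rewrite /sqnorm trmx_mul mulmxA -(mulmxA v) Qo mulmx1.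
Qed.

Lemma normalize_row n (v : 'rV[R]_n) : v != 0 ->
  exists2 a : R, a != 0 & sqnorm (a *: v) = 1.
Proof.
rewrite -sqnorm_gt0 => v0; exists (Num.sqrt (sqnorm v))^-1.
  by rewrite invr_eq0 gt_eqF // sqrtr_gt0.
by rewrite sqnormZ exprVn sqr_sqrtr ?ltW // mulVf // gt_eqF.
Qed.

(** A unit vector u completes to an orthonormal basis: the reflection in the
    hyperplane orthogonal to u - e_0 exchanges e_0 and u. *)
Lemma householder n (u : 'rV[R]_n.+1) : sqnorm u = 1 ->
  exists2 Q : 'M[R]_n.+1, orthogonal_mx Q & row 0 Q = u.
Proof.
move=> u1; pose e : 'rV[R]_n.+1 := delta_mx 0 0.
have [w wE] : exists w, w = u - e by exists (u - e).
have eM (Q : 'M[R]_n.+1) : row 0 Q = e *m Q by rewrite rowE.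
have [w0|wn0] := eqVneq w 0.
  exists 1%:M; first exact: orthogonal_mx1.
  by rewrite eM mulmx1; apply/esym/eqP; rewrite -subr_eq0 -wE w0.
pose c := 2 / sqnorm w.
have sw : sqnorm w != 0 by rewrite sqnorm_eq0.
exists (1%:M - c *: (w^T *m w)).
  rewrite /orthogonal_mx trmxB trmx1 trmxZ trmx_mul trmxK.
  rewrite mulmxBl mul1mx mulmxBr mulmx1 -scalemxAl -scalemxAr.
  rewrite [X in c *: (c *: X)](_ : _ = sqnorm w *: (w^T *m w)); last first.
    by rewrite mulmxA -(mulmxA _ w) mul_row_tr mul_mx_scalar scalemxAl.
  rewrite !scalerA -addrA -[- _ - _]opprD -scalerBl -scalerDl.
  have -> : c + (c - c * c * sqnorm w) = 0 by rewrite /c; field.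
  by rewrite scale0r subr0.
rewrite eM mulmxBr mulmx1 -scalemxAr mulmxA.
have ee : e *m e^T = 1%:M.
  by rewrite /e trmx_delta mul_delta_mx; apply/matrixP => i j; rewrite !mxE !ord1.
have ew : e *m w^T = (u 0 0 - 1)%:M.
  rewrite wE trmxB mulmxBr ee; apply/matrixP => i j; rewrite !ord1 !mxE.
  rewrite (bigD1 0) //= big1 ?addr0 => [|k kn0]; rewrite !mxE ?eqxx ?mul1r //=.
  by rewrite (negbTE kn0) mul0r.
have sqnormw : sqnorm w = 2 - 2 * u 0 0.
  have ue : (e *m u^T) 0 0 = u 0 0.
    move: (congr1 (fun A : 'M[R]_1 => A 0 0) ew).
    by rewrite wE trmxB mulmxBr ee !mxE /= mulr1n; lra.
  have uet : (u *m e^T) 0 0 = u 0 0.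
    by rewrite -ue -[u *m e^T]trmxK trmx_mul trmxK mxE.
  rewrite /sqnorm wE trmxB mulmxBl !mulmxBr ee.
  move: u1; rewrite /sqnorm => u1.
  by move: ue uet u1; rewrite !mxE /= => -> -> ->; rewrite mulr1n; ring.
rewrite ew mul_scalar_mx scalerA.
have -> : c * (u 0 0 - 1) = -1.
  move: sw; rewrite /c sqnormw => sw; have d : 2 - 2 * u 0 0 != 0 by [].
  by field.
by rewrite scaleN1r opprK wE addrC subrK.
Qed.

End Orthogonal.

Section CommonEigenvector.
Import complex.
Local Open Scope complex_scope.
Variable R : realType.

Local Notation toC := (map_mx (real_complex R)).

(** Commuting matrices have a common complex eigenvector z = x + i y.  Symmetry
    forces its eigenvalues to be real: comparing x S y^T with y S x^T for an
    eigenvalue r of S gives Im r (|x|^2 + |y|^2) = 0.  So x and y are eigenvectors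
    for the same eigenvalues, and one of them is nonzero. *)
Lemma common_real_eigenvector n (A B : 'M[R]_n.+1) :
  A^T = A -> B^T = B -> A *m B = B *m A ->
  exists (v : 'rV[R]_n.+1) (a b : R),
    [/\ sqnorm v = 1, v *m A = a *: v & v *m B = b *: v].
Proof.
move=> At Bt AB.
have cAB : toC A *m toC B = toC B *m toC A by rewrite -!map_mxM AB.
have [z z0 /andP[/sub_rVP[p zA] /sub_rVP[q zB]]] := common_eigenvector2 (ltn0Sn n) cAB.
pose x := map_mx (@Re R) z; pose y := map_mx (@Im R) z.
have xy0 : 0 < sqnorm x + sqnorm y.
  rewrite lt_def addr_ge0 ?sqnorm_ge0 // andbT paddr_eq0 ?sqnorm_ge0 // !sqnorm_eq0.
  apply: contra z0 => /andP[/eqP x0 /eqP y0]; apply/eqP/rowP => i; rewrite mxE.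
  move: (congr1 (fun u : 'rV_n.+1 => u 0 i) x0) (congr1 (fun u : 'rV_n.+1 => u 0 i) y0).
  by rewrite !mxE; case: (z 0 i) => /= ? ? -> ->.
have key (S : 'M[R]_n.+1) (r : R[i]) : S^T = S -> z *m toC S = r *: z ->
    x *m S = Re r *: x /\ y *m S = Re r *: y.
  move=> St zS.
  have hRe : x *m S = Re r *: x - Im r *: y.
    apply/rowP => i; move: (congr1 (fun u : 'rV_n.+1 => Re (u 0 i)) zS).
    rewrite !mxE raddf_sum /= => h.
    transitivity (Re (r * z 0 i)); last by case: (r) (z 0 i) => [? ?] [? ?].
    rewrite -h; apply: eq_bigr => j _; rewrite !mxE.
    by case: (z 0 j) => ? ? /=; rewrite mulr0 subr0.
  have hIm : y *m S = Im r *: x + Re r *: y.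
    apply/rowP => i; move: (congr1 (fun u : 'rV_n.+1 => Im (u 0 i)) zS).
    rewrite !mxE raddf_sum /= => h.
    transitivity (Im (r * z 0 i)); last first.
      by case: (r) (z 0 i) => [? ?] [? ?] /=; rewrite addrC.
    rewrite -h; apply: eq_bigr => j _; rewrite !mxE.
    by case: (z 0 j) => ? ? /=; rewrite mulr0 add0r.
  suff r0 : Im r = 0 by rewrite hRe hIm r0 !scale0r subr0 add0r.
  have sym : (x *m S *m y^T) 0 0 = (y *m S *m x^T) 0 0.
    by rewrite -[RHS](mxE trmx_key (fun i j => _ j i)) -/(trmx _) !trmx_mul trmxK St mulmxA.
  move: sym; rewrite hRe hIm mulmxBl mulmxDl -!scalemxAl !mul_row_tr.
  have -> : y *m x^T = x *m y^T.
    by rewrite -[LHS]trmxK trmx_mul trmxK [LHS]mx11_scalar [RHS]mx11_scalar !mxE.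
  rewrite !mxE /= !mulr1n => h.
  have : Im r * (sqnorm x + sqnorm y) = 0 by move: h; lra.
  by move/eqP; rewrite mulf_eq0 (gt_eqF xy0) orbF => /eqP.
have [xA yA] := key A p At zA; have [xB yB] := key B q Bt zB.
have [w [w0 wA wB]] : exists w : 'rV[R]_n.+1,
    [/\ w != 0, w *m A = Re p *: w & w *m B = Re q *: w].
  have [x0|xn0] := eqVneq x 0; last by exists x.
  exists y; split=> //; rewrite -sqnorm_gt0.
  by move: xy0; rewrite x0 {1}/sqnorm mul0mx mxE add0r.
have [a a0 aw] := normalize_row w0.
exists (a *: w), (Re p), (Re q); split=> //.
  by rewrite -scalemxAl wA !scalerA mulrC.
by rewrite -scalemxAl wB !scalerA mulrC.
Qed.

End CommonEigenvector.

(** * Diagonalization and singular value decomposition *)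

Definition nonincreasing (R : realType) n (s : 'rV[R]_n) :=
  forall i j : 'I_n, (i <= j)%N -> s 0 j <= s 0 i.

(** Stated for an arbitrary total preorder because both the usual order and the
    lexicographic order on pairs are used below. *)
Lemma sort_perm (T : eqType) (r : rel T) n (f : 'I_n -> T) :
  total r -> transitive r ->
  exists p : {perm 'I_n}, forall i j : 'I_n, (i <= j)%N -> r (f (p i)) (f (p j)).
Proof.
move=> rtot rtr; pose t := [tuple f i | i < n].
have /tuple_permP[p tE] : perm_eq (sort r t) t by rewrite perm_sort.
exists p => i j ij.
have rE k : tnth t (p k) = nth (f i) (sort r t) k.
  rewrite tE -[X in nth _ _ X]/(nat_of_ord k) -tnth_nth.
  by rewrite tnth_mktuple.
have fE k : f (p k) = nth (f i) (sort r t) k by rewrite -rE tnth_mktuple.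
have rrefl : reflexive r by move=> x; have := rtot x x; rewrite orbb.
rewrite !fE; apply: (sorted_leq_nth rtr rrefl _ (sort_sorted rtot t)) => //;
  by rewrite inE size_sort size_tuple.
Qed.

Section Diagonalization.
Variable R : realType.

Lemma mul_conj_mx p q m n (U : 'M[R]_(p, m)) (U' : 'M[R]_m) (X : 'M[R]_(m, n))
    (V : 'M[R]_(q, n)) (V' : 'M[R]_n) :
  (U *m U') *m X *m (V *m V')^T = U *m (U' *m X *m V'^T) *m V^T.
Proof. by rewrite trmx_mul !mulmxA. Qed.

Lemma symmetric_conj m n (P : 'M[R]_(m, n)) (S : 'M[R]_n) :
  S^T = S -> (P *m S *m P^T)^T = P *m S *m P^T.
Proof. by move=> St; rewrite !trmx_mul trmxK St mulmxA. Qed.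

Lemma block1_conj m n (U : 'M[R]_m) (V : 'M[R]_n) (C : 'M[R]_1)
    (X : 'M[R]_(m, n)) :
  block_mx (1%:M : 'M[R]_1) 0 0 U *m block_mx C 0 0 X *m
    (block_mx (1%:M : 'M[R]_1) 0 0 V)^T = block_mx C 0 0 (U *m X *m V^T).
Proof.
rewrite tr_block_mx !mulmx_block !trmx0 trmx1.
by rewrite !(mulmx0, mul0mx, mulmx1, mul1mx, addr0, add0r).
Qed.

Lemma corner_block m n (Y : 'M[R]_(1 + m, 1 + n)) (c : R) :
  row 0 Y = c *: delta_mx 0 0 -> row 0 Y^T = c *: delta_mx 0 0 ->
  Y = block_mx (c%:M : 'M[R]_1) 0 0 (drsubmx Y).
Proof.
move=> r0 c0.
have Y0j j : Y 0 j = c * (j == 0)%:R.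
  by move: (congr1 (fun u : 'rV[R]_(1 + n) => u 0 j) r0); rewrite !mxE.
have Yi0 i : Y i 0 = c * (i == 0)%:R.
  by move: (congr1 (fun u : 'rV[R]_(1 + m) => u 0 i) c0); rewrite !mxE.
have l0 k (i : 'I_1) : lshift k i = 0 by apply/val_inj; rewrite ord1.
rewrite -[LHS]submxK; congr block_mx; apply/matrixP => i j; rewrite !mxE l0.
- by rewrite Y0j l0 !ord1 /= mulr1n mulr1.
- by rewrite Y0j mulr0.
- by rewrite Yi0 mulr0.
Qed.

Lemma row0_conj n (Q S : 'M[R]_(1 + n)) (v : 'rV[R]_(1 + n)) (a : R) :
  orthogonal_mx Q -> row 0 Q = v -> v *m S = a *: v ->
  row 0 (Q *m S *m Q^T) = a *: delta_mx 0 0.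
Proof.
move=> Qo Q0 vS; rewrite !row_mul Q0 vS -scalemxAl -Q0 -row_mul Qo.
by rewrite rowE mulmx1.
Qed.

Lemma diag_mx_block n (a : R) (d : 'rV[R]_n) :
  diag_mx (row_mx (a%:M : 'M[R]_1) d) = block_mx (a%:M : 'M[R]_1) 0 0 (diag_mx d).
Proof.
by rewrite diag_mx_row; congr block_mx; apply/matrixP => i j; rewrite !ord1 !mxE.
Qed.

(** Deflation: in an orthonormal basis starting with a common eigenvector both
    matrices split off a 1 x 1 block, and the remaining blocks are again symmetric
    and commute. *)
Lemma simultaneous_diagonalization n (A B : 'M[R]_n) :
  A^T = A -> B^T = B -> A *m B = B *m A ->
  exists (Q : 'M[R]_n) (a b : 'rV[R]_n),
    [/\ orthogonal_mx Q, Q *m A *m Q^T = diag_mx a & Q *m B *m Q^T = diag_mx b].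
Proof.
elim: n A B => [|n IHn] A B At Bt AB.
  exists 1%:M, 0, 0; split; first exact: orthogonal_mx1.
  - by apply/matrixP => -[].
  - by apply/matrixP => -[].
have [v [a [b [v1 vA vB]]]] := common_real_eigenvector At Bt AB.
have [Q Qo Q0] := householder v1.
have QtQ : Q^T *m Q = 1%:M by apply: mulmx1C.
pose cj (S : 'M[R]_(1 + n)) : 'M[R]_(1 + n) := Q *m S *m Q^T.
have cjt S : S^T = S -> (cj S)^T = cj S.
  by move=> St; rewrite /cj !trmx_mul trmxK St mulmxA.
have cjM S T : cj S *m cj T = cj (S *m T).
  by rewrite /cj !mulmxA -(mulmxA _ Q^T) QtQ mulmx1.
have cjb S c : S^T = S -> v *m S = c *: v ->
    cj S = block_mx (c%:M : 'M[R]_1) 0 0 (drsubmx (cj S)).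
  move=> St /(row0_conj Qo Q0) r0; apply: corner_block; first exact: r0.
  by rewrite cjt.
have cA := cjb A a At vA; have cB := cjb B b Bt vB.
set A' := drsubmx _ in cA; set B' := drsubmx _ in cB.
have A't : A'^T = A' by rewrite /A' trmx_drsub cjt.
have B't : B'^T = B' by rewrite /B' trmx_drsub cjt.
have AB' : A' *m B' = B' *m A'.
  have := cjM A B; rewrite AB -cjM cA cB !mulmx_block !mul0mx !mulmx0 !add0r.
  by case/eq_block_mx.
have [P [a' [b' [Po PA PB]]]] := IHn A' B' A't B't AB'.
pose P1 := block_mx (1%:M : 'M[R]_1) 0 0 P.
have P1o : orthogonal_mx P1 by apply: orthogonal_block.
have fin S c (S' : 'M[R]_n) d : cj S = block_mx (c%:M : 'M[R]_1) 0 0 S' ->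
    P *m S' *m P^T = diag_mx d ->
    (P1 *m Q) *m S *m (P1 *m Q)^T = diag_mx (row_mx (c%:M : 'M[R]_1) d).
  by move=> cS PS; rewrite mul_conj_mx -/(cj S) cS block1_conj PS diag_mx_block.
exists (P1 *m Q), (row_mx a%:M a'), (row_mx b%:M b'); split.
- exact: orthogonal_mxM.
- exact: fin cA PA.
- exact: fin cB PB.
Qed.

Lemma perm_mx_conj_diag n (p : {perm 'I_n}) (d : 'rV[R]_n) :
  perm_mx p *m diag_mx d *m (perm_mx p)^T = diag_mx (\row_i d 0 (p i)).
Proof.
rewrite tr_perm_mx -col_permE -row_permE; apply/matrixP => i j.
by rewrite !mxE (inj_eq perm_inj).
Qed.

Lemma sort_row n (s : 'rV[R]_n) :
  exists p : {perm 'I_n}, nonincreasing (\row_i s 0 (p i)).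
Proof.
have [||p pP] := @sort_perm R >=%R n (fun i => s 0 i).
- by move=> x y; rewrite /= orbC le_total.
- exact: rev_trans le_trans.
by exists p => i j ij; rewrite !mxE; apply: pP.
Qed.

Lemma spectral_decomposition n (S : 'M[R]_n) : S^T = S ->
  exists (Q : 'M[R]_n) (d : 'rV[R]_n),
    [/\ orthogonal_mx Q, nonincreasing d & Q *m S *m Q^T = diag_mx d].
Proof.
move=> St; have [Q [a [_ [Qo QS _]]]] := simultaneous_diagonalization St St erefl.
have [p pP] := sort_row a.
exists (perm_mx p *m Q), (\row_i a 0 (p i)); split => //.
  by apply: orthogonal_mxM => //; apply: orthogonal_perm.
by rewrite mul_conj_mx QS perm_mx_conj_diag.
Qed.

Lemma rect_diag_block m n (a : R) (s : 'rV[R]_n) :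
  rect_diag_mx (row_mx (a%:M : 'M[R]_1) s) =
  block_mx (a%:M : 'M[R]_1) 0 0 (rect_diag_mx s) :> 'M[R]_(1 + m, 1 + n).
Proof.
apply/matrixP => i j; case: (split_ordP i) => i' ->; case: (split_ordP j) => j' ->.
- by rewrite block_mxEul mxE row_mxEl !ord1 /= mxE mulr1n.
- by rewrite block_mxEur !mxE /= !ord1.
- by rewrite block_mxEdl !mxE /= !ord1.
- by rewrite block_mxEdr mxE row_mxEr mxE /= eqSS.
Qed.

Lemma rect_diag_col m n (s : 'rV[R]_n) :
  rect_diag_mx s = col_mx (diag_mx s) 0 :> 'M[R]_(n + m, n).
Proof.
apply/matrixP => i j; rewrite !mxE; case: splitP => i' -> /=; rewrite !mxE.
  by have [->|] := eqVneq i' j; rewrite ?eqxx // -val_eqE => /negbTE ->.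
by case: eqP => // h; have := ltn_ord j; rewrite -h ltnNge leq_addr.
Qed.

(** Take v a unit eigenvector of X^T X, with eigenvalue a = |X v|^2.  If a <> 0,
    u is X v normalized.  If a = 0 then X has deficient column rank, and since it
    has at least as many rows as columns, its rows are dependent as well: any unit
    u with u X = 0 goes with the singular value 0. *)
Lemma singular_pair m n (X : 'M[R]_(m.+1, n.+1)) : (n <= m)%N ->
  exists (u : 'rV[R]_m.+1) (v : 'rV[R]_n.+1) (s : R),
  [/\ sqnorm u = 1, sqnorm v = 1, 0 <= s, u *m X = s *: v & v *m X^T = s *: u].
Proof.
move=> nm; have XXt : (X^T *m X)^T = X^T *m X by rewrite trmx_mul trmxK.
have [v [a [_ [v1 va _]]]] := common_real_eigenvector XXt XXt erefl.
have aE : a = sqnorm (v *m X^T).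
  rewrite /sqnorm trmx_mul trmxK mulmxA -(mulmxA v) va -scalemxAl !mxE.
  by move: v1; rewrite /sqnorm !mxE => ->; rewrite mulr1.
have a0 : 0 <= a by rewrite aE sqnorm_ge0.
have [a_0|an0] := eqVneq a 0; last first.
  have sa : Num.sqrt a != 0 by rewrite gt_eqF // sqrtr_gt0 lt_def an0.
  exists ((Num.sqrt a)^-1 *: (v *m X^T)), v, (Num.sqrt a); split=> //.
  - by rewrite sqnormZ -aE exprVn sqr_sqrtr // mulVf.
  - rewrite -scalemxAl -mulmxA va scalerA -[X in _ * X](sqr_sqrtr a0) expr2.
    by rewrite mulKf.
  - by rewrite scalerA divff // scale1r.
have vX : v *m X^T = 0 by apply/eqP; rewrite -sqnorm_eq0 -aE a_0.
have /rowV0Pn[u /sub_kermxP uX u0] : kermx X != 0.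
  rewrite -mxrank_eq0 mxrank_ker -lt0n subn_gt0.
  have : kermx X^T != 0.
    apply/rowV0Pn; exists v; first exact/sub_kermxP.
    by rewrite -sqnorm_eq0 v1 oner_eq0.
  rewrite -mxrank_eq0 mxrank_ker mxrank_tr -lt0n subn_gt0 => h.
  exact: leq_trans h _.
have [c c0 cu] := normalize_row u0.
exists (c *: u), v, 0; split=> //.
  by rewrite -scalemxAl uX scaler0 scale0r.
by rewrite vX scale0r.
Qed.

Lemma svd_unsorted m n (X : 'M[R]_(m, n)) : (n <= m)%N ->
  exists (U : 'M[R]_m) (V : 'M[R]_n) (s : 'rV[R]_n),
  [/\ orthogonal_mx U, orthogonal_mx V, forall i, 0 <= s 0 i
    & U *m X *m V^T = rect_diag_mx s].
Proof.
elim: n m X => [|n IHn] m X nm.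
  exists 1%:M, 1%:M, 0; split; try exact: orthogonal_mx1; first by case.
  by apply/matrixP => i [].
case: m X nm => // m X; rewrite ltnS => nm.
have [u [v [c [u1 v1 c0 uX vX]]]] := singular_pair X nm.
have [P Po P0] := householder u1; have [Q Qo Q0] := householder v1.
pose Y : 'M[R]_(1 + m, 1 + n) := P *m X *m Q^T.
have YE : Y = block_mx (c%:M : 'M[R]_1) 0 0 (drsubmx Y).
  have r0 : row 0 Y = c *: delta_mx 0 0.
    by rewrite !row_mul P0 uX -scalemxAl -Q0 -row_mul Qo rowE mulmx1.
  have c0' : row 0 Y^T = c *: delta_mx 0 0.
    rewrite !trmx_mul trmxK mulmxA !row_mul Q0 vX -scalemxAl -P0 -row_mul Po.
    by rewrite rowE mulmx1.
  exact: corner_block.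
have [U [V [s [Uo Vo s0 UV]]]] := IHn m (drsubmx Y) nm.
pose U1 := block_mx (1%:M : 'M[R]_1) 0 0 U.
pose V1 := block_mx (1%:M : 'M[R]_1) 0 0 V.
exists (U1 *m P), (V1 *m Q), (row_mx (c%:M : 'M[R]_1) s); split.
- by apply: orthogonal_mxM => //; apply: orthogonal_block.
- by apply: orthogonal_mxM => //; apply: orthogonal_block.
- by move=> i; rewrite mxE; case: splitP => i' _ //; rewrite ord1 mxE.
by rewrite mul_conj_mx -/Y YE rect_diag_block block1_conj UV.
Qed.

(** The permutation sorting the diagonal acts on the columns, and on the first n
    rows only, through a block matrix. *)
Lemma svd_sorted m n (X : 'M[R]_(m, n)) : (n <= m)%N ->
  exists (U : 'M[R]_m) (V : 'M[R]_n) (s : 'rV[R]_n),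
  [/\ orthogonal_mx U, orthogonal_mx V, forall i, 0 <= s 0 i, nonincreasing s
    & U *m X *m V^T = rect_diag_mx s].
Proof.
move=> nm; move: X; rewrite -(subnKC nm); move: (m - n)%N => k X.
have [U [V [s [Uo Vo s0 UV]]]] := svd_unsorted X (leq_addr k n).
have [p pP] := sort_row s.
pose U1 := block_mx (perm_mx p) 0 0 (1%:M : 'M[R]_k).
exists (U1 *m U), (perm_mx p *m V), (\row_i s 0 (p i)); split => //.
- apply: orthogonal_mxM => //; rewrite /orthogonal_mx /U1 tr_block_mx mulmx_block.
  rewrite trmx1 !trmx0 !(mulmx0, mul0mx, mulmx1, mul1mx, addr0, add0r).
  by rewrite orthogonal_perm -scalar_mx_block.
- by apply: orthogonal_mxM => //; apply: orthogonal_perm.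
- by move=> i; rewrite mxE.
rewrite mul_conj_mx UV !rect_diag_col /U1.
rewrite mul_block_col mul_col_mx !(mulmx0, mul0mx, addr0, add0r).
by rewrite perm_mx_conj_diag.
Qed.

End Diagonalization.

(** * Sorted eigenvalues of a symmetric matrix *)

Section Spectrum.
Variable R : realType.

(** A split monic polynomial determines the multiset of its roots, hence their
    sorted list. *)
Lemma nonincreasing_unique n (s t : 'rV[R]_n) :
  nonincreasing s -> nonincreasing t ->
  \prod_(i < n) ('X - (s 0 i)%:P) = \prod_(i < n) ('X - (t 0 i)%:P) -> s = t.
Proof.
pose l (u : 'rV[R]_n) := [seq u 0 i | i <- enum 'I_n].
have prodE (u : 'rV[R]_n) :
    \prod_(i < n) ('X - (u 0 i)%:P) = \prod_(x <- l u) ('X - x%:P).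
  by rewrite big_map big_enum.
have lsorted (u : 'rV[R]_n) : nonincreasing u -> sorted >=%R (l u).
  move=> uP; have : sorted (fun i j : 'I_n => (i <= j)%N) (enum 'I_n).
    rewrite -(@sorted_map _ _ val leq) val_enum_ord; exact: iota_sorted.
  by apply: homo_sorted => i j; apply: uP.
move=> /lsorted ss /lsorted ts; rewrite !prodE => /prod_XsubC_eq st.
have : l s = l t.
  apply: (sorted_eq _ _ ss ts st); first exact: rev_trans le_trans.
  by move=> x y; rewrite /= andbC => /le_anti.
move=> lE; apply/rowP => i.
have lnth (u : 'rV[R]_n) : u 0 i = nth 0 (l u) i.
  by rewrite (nth_map i) ?size_enum_ord // nth_ord_enum.
by rewrite !lnth lE.
Qed.

Lemma char_poly_orthogonal_conj n (Q S : 'M[R]_n) :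
  orthogonal_mx Q -> char_poly (Q *m S *m Q^T) = char_poly S.
Proof.
move=> Qo; rewrite /char_poly.
have -> : char_poly_mx (Q *m S *m Q^T) =
    map_mx polyC Q *m char_poly_mx S *m map_mx polyC Q^T.
  rewrite /char_poly_mx mulmxBr mulmxBl -!map_mxM mul_mx_scalar -scalemxAl.
  by rewrite -map_mxM Qo map_mx1 scalemx1.
by rewrite !det_mulmx mulrC mulrA -det_mulmx -map_mxM (mulmx1C Qo) map_mx1 det1 mul1r.
Qed.

Lemma char_poly_diag n (d : 'rV[R]_n) :
  char_poly (diag_mx d) = \prod_(i < n) ('X - (d 0 i)%:P).
Proof.
rewrite char_poly_trig ?diag_mx_is_trig //; apply: eq_bigr => i _.
by rewrite mxE eqxx mulr1n.
Qed.

Definition is_spectrum n (S : 'M[R]_n) (d : 'rV[R]_n) :=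
  nonincreasing d /\ char_poly S = \prod_(i < n) ('X - (d 0 i)%:P).

(** For a symmetric matrix exactly one vector qualifies, so the default value 0 is
    not reached. *)
Definition spectrum n (S : 'M[R]_n) : 'rV[R]_n := xget 0 [set d | is_spectrum S d].

Lemma spectrumE n (S : 'M[R]_n) d : is_spectrum S d -> spectrum S = d.
Proof.
move=> Sd; rewrite /spectrum; case: xgetP => [x _ [xi xE]|/(_ d)//].
by case: Sd => di dE; apply: nonincreasing_unique; rewrite -?xE -?dE.
Qed.

Lemma diagonalization_spectrum n (Q S : 'M[R]_n) d : orthogonal_mx Q ->
  nonincreasing d -> Q *m S *m Q^T = diag_mx d -> spectrum S = d.
Proof.
move=> Qo di QS; apply: spectrumE; split=> //.
by rewrite -(char_poly_orthogonal_conj S Qo) QS char_poly_diag.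
Qed.

Lemma spectrum_diagonalization n (S : 'M[R]_n) : S^T = S ->
  exists2 Q : 'M[R]_n, orthogonal_mx Q & Q *m S *m Q^T = diag_mx (spectrum S).
Proof.
move=> /spectral_decomposition[Q [d [Qo di QS]]].
by exists Q => //; rewrite QS (diagonalization_spectrum Qo di QS).
Qed.

Lemma spectrum_is_spectrum n (S : 'M[R]_n) : S^T = S -> is_spectrum S (spectrum S).
Proof.
move=> /spectral_decomposition[Q [d [Qo di QS]]].
rewrite (diagonalization_spectrum Qo di QS); split=> //.
by rewrite -(char_poly_orthogonal_conj S Qo) QS char_poly_diag.
Qed.

Lemma spectrum_nonincreasing n (S : 'M[R]_n) :
  S^T = S -> nonincreasing (spectrum S).
Proof. by case/spectrum_is_spectrum. Qed.

Lemma spectrum_conj n (Q S : 'M[R]_n) : S^T = S -> orthogonal_mx Q ->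
  spectrum (Q *m S *m Q^T) = spectrum S.
Proof.
move=> /spectrum_is_spectrum[Si SE] Qo; apply: spectrumE; split=> //.
by rewrite char_poly_orthogonal_conj.
Qed.

End Spectrum.

Section SingularValueDecomposition.
Variables (R : realType) (m n : nat).
Hypothesis le_nm : (n <= m)%N.
Implicit Types X : 'M[R]_(m, n).

Lemma rect_diag_mx_gram (s : 'rV[R]_n) :
  (rect_diag_mx s : 'M[R]_(m, n))^T *m rect_diag_mx s = diag_mx (\row_i s 0 i ^+ 2).
Proof.
move: (m) (subnKC le_nm) => m' <-; rewrite rect_diag_col tr_col_mx mul_row_col.
rewrite trmx0 mul0mx addr0 tr_diag_mx; apply/matrixP => i j; rewrite mxE.
rewrite (bigD1 i) //= big1 ?addr0 => [|k ki]; rewrite !mxE.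
  by rewrite eqxx mulr1n expr2; case: eqP => [->|]; rewrite ?mulr1n ?mulr0n ?mulr0.
by rewrite eq_sym (negbTE ki) mulr0n mul0r.
Qed.

Lemma svd_singular_values X (U : 'M[R]_m) (V : 'M[R]_n) (s : 'rV[R]_n) :
  orthogonal_mx U -> orthogonal_mx V -> (forall i, 0 <= s 0 i) ->
  nonincreasing s -> U *m X *m V^T = rect_diag_mx s -> is_singular_values X s.
Proof.
move=> Uo Vo s0 si UX; split=> //.
rewrite -(char_poly_orthogonal_conj _ Vo).
have -> : V *m (X^T *m X) *m V^T = diag_mx (\row_i s 0 i ^+ 2).
  rewrite -rect_diag_mx_gram -UX !trmx_mul trmxK !mulmxA.
  by rewrite -(mulmxA _ U^T) (mulmx1C Uo) mulmx1.
by rewrite char_poly_diag; apply: eq_bigr => i _; rewrite mxE.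
Qed.

Lemma is_singular_values_unique X s t :
  is_singular_values X s -> is_singular_values X t -> s = t.
Proof.
move=> [s0 si sE] [t0 ti tE].
have : (\row_i s 0 i ^+ 2) = (\row_i t 0 i ^+ 2) :> 'rV[R]_n.
  apply: nonincreasing_unique.
  - by move=> i j ij; rewrite !mxE ler_sqr ?nnegrE //; apply: si.
  - by move=> i j ij; rewrite !mxE ler_sqr ?nnegrE //; apply: ti.
  under eq_bigr do rewrite mxE; under [RHS]eq_bigr do rewrite mxE.
  by rewrite -sE -tE.
move=> st; apply/rowP => i; move: (congr1 (fun u : 'rV[R]_n => u 0 i) st).
by rewrite !mxE => /eqP; rewrite eqrXn2 // => /eqP.
Qed.

Lemma svd X : exists (U : 'M[R]_m) (V : 'M[R]_n),
  [/\ orthogonal_mx U, orthogonal_mx V, is_singular_values X (sigma X)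
    & U *m X *m V^T = rect_diag_mx (sigma X)].
Proof.
have [U [V [s [Uo Vo s0 si UX]]]] := svd_sorted X le_nm.
have sX := svd_singular_values Uo Vo s0 si UX.
have <- : s = sigma X.
  rewrite /sigma; case: xgetP => [x _ xP|/(_ s)//].
  exact: is_singular_values_unique sX xP.
by exists U, V.
Qed.

End SingularValueDecomposition.

(** * Weyl's inequality *)

Section MatrixNorm.
Variable R : realType.

Lemma mx_norm_le m n (A : 'M[R]_(m, n)) (c : R) : 0 <= c ->
  (`|A| <= c) <-> (forall i j, `|A i j| <= c).
Proof.
move=> c0; rewrite [`|A|]mx_normrE; split=> [/bigmax_leP[_ h] i j|h].
  exact: (h (i, j)).
by apply/bigmax_leP; split=> // -[i j] _; apply: h.
Qed.

Lemma mx_entry_le m n (A : 'M[R]_(m, n)) i j : `|A i j| <= `|A|.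
Proof. by move: i j; apply/mx_norm_le. Qed.

Lemma mx_norm_tr m n (A : 'M[R]_(m, n)) : `|A^T| = `|A|.
Proof.
have le p q (B : 'M[R]_(p, q)) : `|B^T| <= `|B|.
  by apply/mx_norm_le => // i j; rewrite mxE mx_entry_le.
by apply/eqP; rewrite eq_le le -{1}[A]trmxK le.
Qed.

Lemma mx_norm_mulmx m n p (A : 'M[R]_(m, n)) (B : 'M[R]_(n, p)) :
  `|A *m B| <= n%:R * (`|A| * `|B|).
Proof.
apply/mx_norm_le => [|i j]; first by rewrite !mulr_ge0.
rewrite mxE (le_trans (ler_norm_sum _ _ _)) //.
rewrite mulr_natl -[n in _ *+ n]card_ord -sumr_const; apply: ler_sum => k _.
by rewrite normrM ler_pM // mx_entry_le.
Qed.

Lemma sqr_entry_le_sqn n (v : 'rV[R]_n) i : v 0 i ^+ 2 <= sqnorm v.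
Proof.
by rewrite sqnormE (bigD1 i) //= lerDl sumr_ge0 // => j _; rewrite sqr_ge0.
Qed.

Lemma orthogonal_mx_norm n (Q : 'M[R]_n) : orthogonal_mx Q -> `|Q| <= 1.
Proof.
move=> Qo; apply/mx_norm_le => // i j.
rewrite -(@ler_pXn2r _ 2) ?nnegrE // expr1n real_normK ?num_real //.
have -> : Q i j = (row i Q) 0 j by rewrite mxE.
apply: le_trans (sqr_entry_le_sqn _ _) _.
have -> : sqnorm (row i Q) = (Q *m Q^T) i i.
  by rewrite /sqnorm !mxE; apply: eq_bigr => k _; rewrite !mxE.
by rewrite Qo mxE eqxx.
Qed.

Lemma quadratic_form_le n (E : 'M[R]_n) (v : 'rV[R]_n) :
  `|(v *m E *m v^T) 0 0| <= n%:R ^+ 2 * `|E| * sqnorm v.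
Proof.
have vv i j : `|v 0 i| * `|v 0 j| <= sqnorm v.
  have := sqr_entry_le_sqn v i; have := sqr_entry_le_sqn v j.
  rewrite -[v 0 i ^+ 2]real_normK ?num_real // -[v 0 j ^+ 2]real_normK ?num_real //.
  have := sqr_ge0 (`|v 0 i| - `|v 0 j|); nra.
rewrite mxE (le_trans (ler_norm_sum _ _ _)) //.
rewrite expr2 -!mulrA mulr_natl -[n in _ *+ n]card_ord -sumr_const.
apply: ler_sum => k _; rewrite !mxE mulr_suml (le_trans (ler_norm_sum _ _ _)) //.
rewrite mulr_natl -[n in _ *+ n]card_ord -sumr_const; apply: ler_sum => l _.
rewrite !normrM [`|v 0 l| * _]mulrC -mulrA; apply: ler_pM => //.
exact: mx_entry_le.
Qed.

End MatrixNorm.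

Section Weyl.
Variable R : realType.

Lemma quadratic_form_diag n (d w : 'rV[R]_n) :
  (w *m diag_mx d *m w^T) 0 0 = \sum_j d 0 j * w 0 j ^+ 2.
Proof.
rewrite mxE; apply: eq_bigr => j _; rewrite mul_mx_diag !mxE expr2.
by rewrite mulrAC mulrC mulrA.
Qed.

(** Dimension count behind the min-max principle: the span of the first i + 1 basis
    vectors meets the subspace cut out by the i equations (w Z)_k = 0, k < i.
    Both families of conditions are columns of one square matrix N whose i-th
    column vanishes. *)
Lemma test_vector n (Z : 'M[R]_n) (i : 'I_n) :
  exists w : 'rV[R]_n, [/\ w != 0, forall k : 'I_n, (i < k)%N -> w 0 k = 0
    & forall k : 'I_n, (k < i)%N -> (w *m Z) 0 k = 0].
Proof.
pose N := \matrix_(j < n, k < n)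
  (if (k < i)%N then Z j k else if k == i then 0 else (j == k)%:R).
have : \det N == 0.
  rewrite -det_tr; apply/det0P; exists (delta_mx 0 i).
    apply/negP => /eqP/rowP/(_ i)/eqP; by rewrite !mxE !eqxx oner_eq0.
  by rewrite -rowE; apply/rowP => j; rewrite !mxE ltnn eqxx.
move=> /det0P[w w0 wN]; exists w; split=> // k ik.
  move: (congr1 (fun u : 'rV[R]_n => u 0 k) wN); rewrite !mxE => {1}<-.
  have ki : (k == i) = false by rewrite -val_eqE gtn_eqF.
  rewrite (bigD1 k) //= big1 => [|j jk]; rewrite !mxE ltnNge (ltnW ik) /= ki.
    by rewrite eqxx mulr1 addr0.
  by rewrite (negbTE jk) mulr0.
move: (congr1 (fun u : 'rV[R]_n => u 0 k) wN); rewrite !mxE; apply: etrans.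
by apply: eq_bigr => j _; rewrite mxE ik.
Qed.

(** The test vector lies in the span of eigenvectors of S for eigenvalues at least
    s_i and in the span of eigenvectors of T for eigenvalues at most t_i, so its
    Rayleigh quotients for S and T compare s_i with t_i. *)
Lemma spectrum_sub_le n (S T : 'M[R]_n) (i : 'I_n) : S^T = S -> T^T = T ->
  spectrum S 0 i - spectrum T 0 i <= n%:R ^+ 2 * `|S - T|.
Proof.
move=> St Tt.
have [Q Qo QS] := spectrum_diagonalization St.
have [P Po PT] := spectrum_diagonalization Tt.
have si := spectrum_nonincreasing St; have ti := spectrum_nonincreasing Tt.
set s := spectrum S in QS si *; set t := spectrum T in PT ti *.
pose Z := Q *m P^T; have Zo : orthogonal_mx Z.
  by apply: orthogonal_mxM => //; apply: orthogonal_mx_tr.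
have [w [w0 w_gt wZ_lt]] := test_vector Z i.
have wS : s 0 i * sqnorm w <= (w *m Q *m S *m (w *m Q)^T) 0 0.
  rewrite mul_conj_mx QS quadratic_form_diag.
  rewrite sqnormE mulr_sumr; apply: ler_sum => j _.
  have [ji|ij] := leqP j i; first by rewrite ler_wpM2r ?sqr_ge0 ?si.
  by rewrite w_gt // expr0n !mulr0.
have wT : (w *m Q *m T *m (w *m Q)^T) 0 0 <= t 0 i * sqnorm w.
  have -> : w *m Q = w *m Z *m P.
    by rewrite /Z -!mulmxA (mulmx1C Po) mulmx1.
  rewrite mul_conj_mx PT quadratic_form_diag.
  rewrite -(sqnormM_orthogonal w Zo) sqnormE mulr_sumr; apply: ler_sum => j _.
  have [ij|ji] := leqP i j; first by rewrite ler_wpM2r ?sqr_ge0 ?ti.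
  by rewrite wZ_lt // expr0n !mulr0.
have := le_trans (ler_norm _) (quadratic_form_le (S - T) (w *m Q)).
rewrite mulmxBr mulmxBl mxE [X in _ + X]mxE (sqnormM_orthogonal w Qo) => h.
rewrite -(@ler_pM2r _ (sqnorm w)) ?sqnorm_gt0 // mulrBl.
exact: le_trans (lerB wS wT) h.
Qed.

Lemma spectrum_lipschitz n (S T : 'M[R]_n) (i : 'I_n) : S^T = S -> T^T = T ->
  `|spectrum S 0 i - spectrum T 0 i| <= n%:R ^+ 2 * `|S - T|.
Proof.
move=> St Tt; rewrite ler_norml spectrum_sub_le // andbT.
by rewrite lerNl opprB distrC spectrum_sub_le.
Qed.

End Weyl.

(** * Sorted eigenvalues along a line *)

Section BoundedFamilies.
Variable R : realType.

(** The interval [0, 1] makes the class stable under multiplication by t; only small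
    t matter. *)
Definition bounded_family m n (f : R -> 'M[R]_(m, n)) :=
  exists c, forall t, 0 <= t <= 1 -> `|f t| <= c.

Lemma bounded_cst m n (A : 'M[R]_(m, n)) : bounded_family (fun=> A).
Proof. by exists `|A|. Qed.

Lemma bounded_add m n (f g : R -> 'M[R]_(m, n)) :
  bounded_family f -> bounded_family g -> bounded_family (fun t => f t + g t).
Proof.
move=> [c fc] [d gd]; exists (c + d) => t t01.
by rewrite (le_trans (ler_normD _ _)) // lerD ?fc ?gd.
Qed.

Lemma bounded_mulmx m n p (f : R -> 'M[R]_(m, n)) (g : R -> 'M[R]_(n, p)) :
  bounded_family f -> bounded_family g -> bounded_family (fun t => f t *m g t).
Proof.
move=> [c fc] [d gd]; exists (n%:R * (c * d)) => t t01.
rewrite (le_trans (mx_norm_mulmx _ _)) // ler_wpM2l // ler_pM //; [exact: fc|exact: gd].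
Qed.

Lemma bounded_tr m n (f : R -> 'M[R]_(m, n)) :
  bounded_family f -> bounded_family (fun t => (f t)^T).
Proof. by move=> [c fc]; exists c => t t01; rewrite mx_norm_tr fc. Qed.

Lemma bounded_scale m n (f : R -> 'M[R]_(m, n)) :
  bounded_family f -> bounded_family (fun t => t *: f t).
Proof.
move=> [c fc]; exists c => t t01; rewrite normrZ.
have /andP[t0 t1] := t01; rewrite (ger0_norm t0) (le_trans _ (fc t t01)) //.
by rewrite ler_piMl.
Qed.

End BoundedFamilies.

Section Cayley.
Variable R : realType.

Definition cayley n (K : 'M[R]_n) := (1%:M + K) *m invmx (1%:M - K).

Variables (n : nat) (K : 'M[R]_n).
Hypothesis skewK : K^T = - K.

(** A skew matrix satisfies v K v^T = 0, so v = v K forces |v|^2 = 0. *)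
Lemma skew_unit : 1%:M - K \in unitmx.
Proof.
rewrite unitmxE unitfE; apply/det0P => -[v v0 /eqP].
rewrite mulmxBr mulmx1 subr_eq0 => /eqP vK.
have e : (v *m K *m v^T)^T = - (v *m K *m v^T).
  by rewrite !trmx_mul trmxK skewK mulmxA mulmxN mulNmx.
have : (v *m K *m v^T) 0 0 = - (v *m K *m v^T) 0 0.
  by have := congr1 (fun A : 'M[R]_1 => A 0 0) e; rewrite [in LHS]mxE [in RHS]mxE.
rewrite -vK => h; have : sqnorm v = 0 by rewrite /sqnorm; lra.
by move/eqP; rewrite sqnorm_eq0 (negbTE v0).
Qed.

Lemma cayley_mul : cayley K *m (1%:M - K) = 1%:M + K.
Proof. by rewrite /cayley mulmxKV // skew_unit. Qed.

Lemma mul_cayley : (1%:M - K) *m cayley K = 1%:M + K.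
Proof.
rewrite /cayley mulmxA; have -> : (1%:M - K) *m (1%:M + K) = (1%:M + K) *m (1%:M - K).
  transitivity (1%:M - K *m K).
    by rewrite mulmxBl mul1mx mulmxDr mulmx1 opprD addrA addrK.
  by rewrite mulmxDl mul1mx mulmxBr mulmx1 addrA subrK.
by rewrite mulmxK // skew_unit.
Qed.

Lemma cayley_orthogonal : orthogonal_mx (cayley K).
Proof.
have u := skew_unit; have u' : 1%:M + K \in unitmx.
  by have := u; rewrite -unitmx_tr trmxB trmx1 skewK opprK.
have h1 : (cayley K)^T *m (1%:M + K) = 1%:M - K.
  by have := congr1 trmx mul_cayley; rewrite trmx_mul trmxB trmxD trmx1 skewK opprK.
have h2 : (1%:M + K) *m (cayley K)^T = 1%:M - K.
  by have := congr1 trmx cayley_mul; rewrite trmx_mul trmxB trmxD trmx1 skewK opprK.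
have h3 : (1%:M - K) *m (cayley K *m (cayley K)^T) = (1%:M - K).
  by rewrite mulmxA mul_cayley h2.
by rewrite /orthogonal_mx -[LHS](mulKmx u) h3 mulVmx.
Qed.

(** An exact second-order expansion: since (1 - K)^-1 = (Q + 1) / 2 for the Cayley
    transform Q, the remainder is expressed with Q itself, whose entries are bounded
    by 1. *)
Lemma cayley_expansion : cayley K = 1%:M + 2 *: K + K *m K *m (cayley K + 1%:M).
Proof.
have e : cayley K = 1%:M + K *m (cayley K + 1%:M).
  have := mul_cayley; rewrite mulmxBl mul1mx mulmxDr mulmx1 => /eqP.
  by rewrite subr_eq => /eqP {1}->; rewrite addrA addrAC.
rewrite {1}e -mulmxA; apply/eqP; rewrite -addrA; apply/eqP; congr (_ + _).
have e2 : cayley K + 1%:M = 2 *: 1%:M + K *m (cayley K + 1%:M).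
  by rewrite {1}e addrAC -[1%:M + 1%:M]mulr2n -scaler_nat.
by rewrite {1}e2 [LHS]mulmxDr -scalemxAr mulmx1.
Qed.

End Cayley.

Section FirstOrder.
Variable R : realType.

Lemma diag_commutator n (a : 'rV[R]_n) (K : 'M[R]_n) i j :
  (diag_mx a *m K - K *m diag_mx a) i j = (a 0 i - a 0 j) * K i j.
Proof. by rewrite mul_diag_mx mul_mx_diag !mxE; ring. Qed.

(** Conjugation by a near-identity matrix 1 + t X with X = K + t E changes B into
    its commutator correction M at first order; everything else carries t^2. *)
Lemma near_identity_conj n (A B K E M : 'M[R]_n) (t : R) : K^T = - K ->
  B + (A *m K - K *m A) = M ->
  let X := K + t *: E in
  (1%:M + t *: X)^T *m (A + t *: B) *m (1%:M + t *: X) =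
  A + t *: M + (t ^+ 2) *: (E^T *m A + A *m E + X^T *m A *m X + X^T *m B + B *m X
                            + t *: (X^T *m B *m X)).
Proof.
move=> Kt <- X.
have XtA : X^T *m A = - (K *m A) + t *: (E^T *m A).
  by rewrite trmxD trmxZ Kt mulmxDl mulNmx -scalemxAl.
have AX : A *m X = A *m K + t *: (A *m E) by rewrite mulmxDr -scalemxAr.
clearbody X; rewrite trmxD trmx1 trmxZ.
rewrite !(mulmxDl, mulmxDr, mul1mx, mulmx1, =^~ scalemxAl, =^~ scalemxAr) XtA AX.
move: (X^T *m A *m X) (X^T *m B *m X) (X^T *m B) (B *m X) (K *m A) (A *m K).
move: (E^T *m A) (A *m E) => c1 c2 c3 c4 c5 c6 c7 c8.
by apply/matrixP => i j; rewrite !mxE; ring.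
Qed.

(** When A is diagonal, the commutator equation M = B + [A, K] is solved entrywise:
    (A K - K A)_ij = (a_i - a_j) K_ij, so K can cancel every entry of B between
    distinct diagonal values, and the entries that remain commute with A. *)
Lemma commuting_first_order n (a : 'rV[R]_n) (B : 'M[R]_n) : B^T = B ->
  exists M : 'M[R]_n, [/\ M^T = M, diag_mx a *m M = M *m diag_mx a
    & exists c, forall t, 0 <= t <= 1 -> forall i,
      `|spectrum (diag_mx a + t *: B) 0 i - spectrum (diag_mx a + t *: M) 0 i|
        <= c * t ^+ 2].
Proof.
move=> Bt; have Bs i j : B i j = B j i by rewrite -[in LHS]Bt mxE.
pose M := \matrix_(i < n, j < n) if a 0 i == a 0 j then B i j else 0.
pose K := \matrix_(i < n, j < n)
  if a 0 i == a 0 j then 0 else B i j / (a 0 j - a 0 i).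
pose A := diag_mx a.
have At : A^T = A by apply: tr_diag_mx.
have Mt : M^T = M by apply/matrixP => i j; rewrite !mxE eq_sym Bs.
have Kt : K^T = - K.
  apply/matrixP => i j; rewrite !mxE eq_sym; case: eqP => _; first by rewrite oppr0.
  by rewrite Bs -mulrN -invrN opprB.
have BM : B + (A *m K - K *m A) = M.
  apply/matrixP => i j; rewrite mxE diag_commutator !mxE.
  case: eqP => [_|/eqP aij]; first by rewrite mulr0 addr0.
  have d : a 0 j - a 0 i != 0 by rewrite subr_eq0 eq_sym.
  by field.
exists M; split=> //.
  apply/eqP; rewrite -subr_eq0; apply/eqP/matrixP => i j.
  rewrite diag_commutator !mxE; case: eqP => [->|_]; last by rewrite mulr0.
  by rewrite subrr mul0r.
pose Q t := cayley ((t / 2) *: K).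
have skew t : ((t / 2) *: K)^T = - ((t / 2) *: K) by rewrite trmxZ Kt scalerN.
have Qo t : orthogonal_mx (Q t) by apply: cayley_orthogonal.
(* The factor t / 2 makes the first-order term of the Cayley transform t K. *)
pose E t := 4^-1 *: (K *m K *m (Q t + 1%:M)).
pose X t := K + t *: E t.
have QX t : Q t = 1%:M + t *: X t.
  rewrite {1}/Q cayley_expansion // -/(Q t) /X /E -!(scalemxAl, scalemxAr).
  rewrite -addrA; congr (_ + _); rewrite scalerDr !scalerA; congr (_ *: _ + _ *: _).
    by field.
  by field.
pose G t := (E t)^T *m A + A *m E t + (X t)^T *m A *m X t + (X t)^T *m B
  + B *m X t + t *: ((X t)^T *m B *m X t).
have [c Gc] : bounded_family G.
  have bQ : bounded_family Q by exists 1 => t _; apply: orthogonal_mx_norm.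
  have bE : bounded_family E.
    rewrite /E; under eq_fun do rewrite -mul_scalar_mx.
    apply: bounded_mulmx; first exact: bounded_cst.
    apply: bounded_mulmx; first exact: bounded_cst.
    by apply: bounded_add => //; apply: bounded_cst.
  have bX : bounded_family X.
    by apply: bounded_add; [exact: bounded_cst | exact: bounded_scale].
  have bXt : bounded_family (fun t => (X t)^T) by apply: bounded_tr.
  have bEt : bounded_family (fun t => (E t)^T) by apply: bounded_tr.
  have bXtA := bounded_mulmx bXt (bounded_cst A).
  have bXtB := bounded_mulmx bXt (bounded_cst B).
  have bG1 := bounded_add (bounded_mulmx bEt (bounded_cst A))
    (bounded_mulmx (bounded_cst A) bE).
  have bG2 := bounded_add (bounded_add bG1 (bounded_mulmx bXtA bX)) bXtB.
  have bG3 := bounded_add bG2 (bounded_mulmx (bounded_cst B) bX).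
  exact: bounded_add bG3 (bounded_scale (bounded_mulmx bXtB bX)).
exists (n%:R ^+ 2 * c) => t t01 i.
have Ft : (A + t *: B)^T = A + t *: B by rewrite trmxD trmxZ At Bt.
have Ht : (A + t *: M)^T = A + t *: M by rewrite trmxD trmxZ At Mt.
rewrite -(spectrum_conj Ft (orthogonal_mx_tr (Qo t))) trmxK.
have QFQ : (Q t)^T *m (A + t *: B) *m Q t = A + t *: M + t ^+ 2 *: G t.
  by rewrite QX (near_identity_conj _ _ Kt BM).
have QFt : ((Q t)^T *m (A + t *: B) *m Q t)^T = (Q t)^T *m (A + t *: B) *m Q t.
  by rewrite -{2 4}[Q t]trmxK symmetric_conj.
apply: le_trans (spectrum_lipschitz i QFt Ht) _.
rewrite QFQ addrAC subrr add0r normrZ normrX.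
have /andP[t0 _] := t01; rewrite (ger0_norm t0) -mulrA ler_wpM2l ?exprn_ge0 //.
by rewrite mulrC ler_wpM2r ?exprn_ge0 // Gc.
Qed.

End FirstOrder.

Section SpectrumAlongLine.
Variable R : realType.

Lemma near0_affine_le (a b a' b' : R) :
  (a' < a) || ((a' == a) && (b' <= b)) ->
  \forall t \near 0^'+, a' + t * b' <= a + t * b.
Proof.
case/orP => [aa|/andP[/eqP -> bb]]; last first.
  by near=> t; rewrite lerD2l ler_wpM2l // ltW.
have d0 : 0 < (a - a') / (`|b' - b| + 1).
  by rewrite divr_gt0 ?subr_gt0 // ltr_wpDl.
near=> t.
have t0 : 0 < t by near: t; exact: nbhs_right_gt.
have : t < (a - a') / (`|b' - b| + 1) by near: t; exact: nbhs_right_lt.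
rewrite ltr_pdivlMr; last by rewrite ltr_wpDl.
have := ler_norm (b' - b); nra.
Unshelve. all: by end_near. Qed.

(** For small t > 0, the numbers a_i + t b_i are ordered like the pairs (a_i, b_i)
    lexicographically, so one permutation sorts them for all such t. *)
Lemma sort_affine n (a b : 'rV[R]_n) : exists p : {perm 'I_n},
  nonincreasing (\row_i a 0 (p i)) /\
  \forall t \near 0^'+, nonincreasing (\row_i (a 0 (p i) + t * b 0 (p i))).
Proof.
pose r (x y : R * R) := (y.1 < x.1) || ((y.1 == x.1) && (y.2 <= x.2)).
have [||p pr] := @sort_perm _ r n (fun i => (a 0 i, b 0 i)).
- move=> [x1 x2] [y1 y2]; rewrite /r /=.
  by case: (ltgtP x1 y1) => //= _; rewrite le_total.
- move=> [x1 x2] [y1 y2] [z1 z2]; rewrite /r /=.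
  case/orP=> [xy|/andP[/eqP <- xy]]; case/orP=> [yz|/andP[/eqP yz yz']].
  + by rewrite (lt_trans yz xy).
  + by rewrite yz xy.
  + by rewrite yz.
  + by rewrite yz eqxx (le_trans yz' xy) orbT.
exists p; split.
  move=> i j /pr; rewrite /r !mxE /=.
  by case/orP=> [/ltW//|/andP[/eqP->]].
suff : \forall t \near (0 : R)^'+, forall i : 'I_n, forall j : 'I_n, (i <= j)%N ->
    a 0 (p j) + t * b 0 (p j) <= a 0 (p i) + t * b 0 (p i).
  by apply: filterS => t h i j ij; rewrite !mxE h.
apply: filter_forall => i; apply: filter_forall => j.
have [ij|ji] := leqP i j; last by near=> t.
by have := near0_affine_le (pr i j ij); apply: filterS.
Unshelve. all: by end_near. Qed.

Lemma diag_mxD_scale n (a b : 'rV[R]_n) t :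
  diag_mx (a + t *: b) = diag_mx a + t *: diag_mx b.
Proof. by rewrite linearD linearZ. Qed.

Lemma spectrum_commuting_line n (A M : 'M[R]_n) : A^T = A -> M^T = M ->
  A *m M = M *m A -> exists b : 'rV[R]_n,
  \forall t \near 0^'+, spectrum (A + t *: M) = spectrum A + t *: b.
Proof.
move=> At Mt AM.
have [P [a [b [Po PA PM]]]] := simultaneous_diagonalization At Mt AM.
have [p [pa pab]] := sort_affine a b.
pose Q := perm_mx p *m P.
have Qo : orthogonal_mx Q by apply: orthogonal_mxM => //; apply: orthogonal_perm.
have QE S d : P *m S *m P^T = diag_mx d ->
    Q *m S *m Q^T = diag_mx (\row_i d 0 (p i)).
  by move=> PS; rewrite mul_conj_mx PS perm_mx_conj_diag.
exists (\row_i b 0 (p i)).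
have -> : spectrum A = \row_i a 0 (p i).
  exact: diagonalization_spectrum Qo pa (QE _ _ PA).
apply: filterS pab => t pabt.
have -> : (\row_i a 0 (p i)) + t *: (\row_i b 0 (p i)) =
          \row_i (a 0 (p i) + t * b 0 (p i)).
  by apply/rowP => i; rewrite !mxE.
apply: (diagonalization_spectrum Qo pabt).
have := QE (A + t *: M) (a + t *: b).
rewrite diag_mxD_scale mulmxDr mulmxDl -scalemxAr -scalemxAl PA PM => ->//.
by congr diag_mx; apply/rowP => i; rewrite !mxE.
Qed.

(** Diagonalize A, replace B by its part M commuting with A at the cost of O(t^2),
    and diagonalize A and M together. *)
Lemma spectrum_line n (A B : 'M[R]_n) : A^T = A -> B^T = B ->
  exists (b : 'rV[R]_n) (c : R), \forall t \near 0^'+, forall i,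
    `|spectrum (A + t *: B) 0 i - (spectrum A 0 i + t * b 0 i)| <= c * t ^+ 2.
Proof.
move=> At Bt; have [Q Qo QA] := spectrum_diagonalization At.
set a := spectrum A in QA *.
have QBt := symmetric_conj Q Bt.
have [M [Mt aM [c cP]]] := commuting_first_order a QBt.
have [b bP] := spectrum_commuting_line (tr_diag_mx a) Mt aM.
have aE : spectrum (diag_mx a) = a by rewrite -QA spectrum_conj.
exists b, c; near=> t => i.
have t01 : 0 <= t <= 1.
  by apply/andP; split; near: t; [exact: nbhs_right_ge|exact: nbhs_right_le].
have := cP t t01 i.
have -> : diag_mx a + t *: (Q *m B *m Q^T) = Q *m (A + t *: B) *m Q^T.
  by rewrite -QA mulmxDr mulmxDl -scalemxAr -scalemxAl.
rewrite spectrum_conj //; last by rewrite trmxD trmxZ At Bt.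
have -> : spectrum (diag_mx a + t *: M) = a + t *: b by near: t; rewrite aE in bP.
by rewrite !mxE.
Unshelve. all: by end_near. Qed.

End SpectrumAlongLine.

(** * Existence of one-sided limits by eventual signs *)

Section RightLimits.
Variable R : realType.

Lemma near0_right_ex (P : R -> Prop) : (\forall t \near 0^'+, P t) ->
  exists2 e, 0 < e & forall t, 0 < t < e -> P t.
Proof.
move=> [e /= e0 eP]; exists e => // t /andP[t0 te]; apply: eP => //=.
by rewrite sub0r normrN gtr0_norm.
Qed.

Lemma near0_right_of (P : R -> Prop) e : 0 < e -> (forall t, 0 < t < e -> P t) ->
  \forall t \near 0^'+, P t.
Proof.
move=> e0 eP; near=> t; apply: eP; apply/andP; split; near: t.
  exact: nbhs_right_gt.
exact: nbhs_right_lt.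
Unshelve. all: by end_near. Qed.

Lemma near0_horner_neq0 (p : {poly R}) : p != 0 ->
  \forall t \near 0^'+, p.[t] != 0.
Proof.
move=> p0; have [m [q]] := multiplicity_XsubC p 0; rewrite p0 /= => q0 ->.
have : \forall t \near 0, q.[t] != 0.
  apply: (@continuous_horner R q 0 [set x | x != 0]).
  exact: open_nbhs_nbhs (conj (@open_neq R 0) q0).
move=> qn; near=> t; rewrite hornerM horner_exp !hornerE mulf_neq0 //.
  by near: t; apply: cvg_within qn.
by rewrite expf_neq0 // gt_eqF // subr0.
Unshelve. all: by end_near. Qed.

(** By the intermediate value theorem. *)
Lemma near0_sign (h : R -> R) : continuous h ->
  (\forall t \near 0^'+, h t != 0) ->
  (\forall t \near 0^'+, h t < 0) \/ (\forall t \near 0^'+, 0 < h t).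
Proof.
move=> hc /near0_right_ex[e e0 hn].
have noroot s t : 0 < s < e -> 0 < t < e -> h s < 0 -> h t < 0.
  move=> se te hs; rewrite ltNge; apply/negP => ht.
  have [c cst /eqP] : exists2 c, 0 < c < e & h c = 0.
    have [st|ts] := leP s t.
      have [||c] := @IVT R h s t 0 st; first exact: continuous_subspaceT.
        by rewrite ge_min (ltW hs) le_max ht orbT.
      rewrite in_itv /= => /andP[sc ct] hc0; exists c => //.
      by move: se te => /andP[? ?] /andP[? ?]; apply/andP; split; lra.
    have [||c] := @IVT R h t s 0 (ltW ts); first exact: continuous_subspaceT.
      by rewrite ge_min (ltW hs) le_max ht orbT.
    rewrite in_itv /= => /andP[tc cs] hc0; exists c => //.
    by move: se te => /andP[? ?] /andP[? ?]; apply/andP; split; lra.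
  by rewrite (negbTE (hn c cst)).
have he : 0 < e / 2 < e by rewrite divr_gt0 //=; lra.
have [h0|h0] := ltP (h (e / 2)) 0; [left|right]; apply: (near0_right_of e0) => t te.
  exact: noroot he te h0.
rewrite lt_def hn //= leNgt; apply/negP => ht.
by have := noroot _ _ te he ht; rewrite ltNge h0.
Qed.

Lemma itv_avoid (s : seq R) u v : u < v -> exists2 c, u < c < v & c \notin s.
Proof.
move=> uv; suff [u' [v' [uu' uv' vv' av]]] : exists u' v',
    [/\ u <= u', u' < v', v' <= v & forall x, x \in s -> ~~ (u' < x < v')].
  exists ((u' + v') / 2); first by apply/andP; split; lra.
  by apply/negP => /av/negP; apply; apply/andP; split; lra.
elim: s => [|x s [u' [v' [uu' uv' vv' av]]]]; first by exists u, v; split.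
have [/andP[ux xv]|xn] := boolP (u' < x < v').
  exists x, v'; split=> //; first by lra.
  move=> y; rewrite inE => /orP[/eqP->|/av]; first by rewrite ltxx.
  by apply: contra => /andP[xy ->]; rewrite (lt_trans ux).
by exists u', v'; split=> // y; rewrite inE => /orP[/eqP->|/av].
Qed.

(** A function that ends up on one side of every level c outside a finite set cannot
    oscillate: its limit is the supremum of its eventual lower bounds. *)
Lemma cvg_of_eventual_sign (g : R -> R) (K : R) (s : seq R) :
  (\forall t \near 0^'+, `|g t| <= K) ->
  (forall c, c \notin s ->
    (\forall t \near 0^'+, g t < c) \/ (\forall t \near 0^'+, c < g t)) ->
  cvg (g t @[t --> 0^'+]).
Proof.
move=> gK gs; pose E := [set c | \forall t \near 0^'+, c <= g t].
have Eub c : E c -> c <= K.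
  move=> Ec; have Fc : \forall t \near 0^'+, c <= g t := Ec.
  near (0 : R)^'+ => t; have ct : c <= g t by near: t.
  have tK : `|g t| <= K by near: t.
  by rewrite (le_trans ct) // (le_trans (ler_norm _)).
have EK : E (- K).
  by apply: filterS gK => t; rewrite ler_norml => /andP[].
have ubE : has_ubound E by exists K => c /Eub.
have supE : has_sup E by split=> //; exists (- K).
apply: (cvgP (sup E)); apply/cvgrPdist_lt => e e0.
have Le1 : sup E - e < sup E by lra.
have Le2 : sup E < sup E + e by lra.
have [c1 /andP[lc1 c1l] /gs c1s] := itv_avoid s Le1.
have [c2 /andP[lc2 c2l] /gs c2s] := itv_avoid s Le2.
have {c1s} h1 : \forall t \near 0^'+, c1 < g t.
  case: c1s => // gc1; have d0 : 0 < sup E - c1 by rewrite subr_gt0.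
  have [c Ec] := sup_adherent d0 supE; rewrite subKr => cc1.
  have Fc : \forall t \near 0^'+, c <= g t := Ec.
  near (0 : R)^'+ => t; have ct : c <= g t by near: t.
  have tc : g t < c1 by near: t.
  by have := lt_trans cc1 (le_lt_trans ct tc); rewrite ltxx.
have {c2s} h2 : \forall t \near 0^'+, g t < c2.
  case: c2s => // gc2; have : E c2 by apply: filterS gc2 => t /ltW.
  by move=> /(ub_le_sup ubE); rewrite leNgt lc2.
near=> t; rewrite ltr_norml.
have t1 : c1 < g t by near: t.
have t2 : g t < c2 by near: t.
by apply/andP; split; lra.
Unshelve. all: by end_near. Qed.

End RightLimits.

(** * Sorted eigenvalues along a parabola *)

Section SpectrumAlongParabola.
Variable R : realType.

Lemma spectrum_cvg n (T : Type) (F : set_system T) {FF : Filter F}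
    (f : T -> 'M[R]_n) (S : 'M[R]_n) i :
  (forall x, (f x)^T = f x) -> S^T = S -> f x @[x --> F] --> S ->
  spectrum (f x) 0 i @[x --> F] --> spectrum S 0 i.
Proof.
move=> ft St fS; apply/cvgrPdist_lt => e e0.
have c0 : 0 < n%:R ^+ 2 + 1 :> R by rewrite ltr_wpDl ?exprn_ge0.
have d0 : 0 < e / (n%:R ^+ 2 + 1) by rewrite divr_gt0.
move/cvgrPdist_lt : fS => /(_ _ d0); apply: filterS => x.
rewrite ltr_pdivlMr // => h; apply: le_lt_trans (spectrum_lipschitz i St (ft x)) _.
by have := normr_ge0 (S - f x); nra.
Qed.

Definition parabola m n (A B C : 'M[R]_(m, n)) (t : R) := A + t *: B + (2^-1 * t ^+ 2) *: C.

Lemma parabola_sym n (A B C : 'M[R]_n) t : A^T = A -> B^T = B -> C^T = C ->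
  (parabola A B C t)^T = parabola A B C t.
Proof. by move=> At Bt Ct; rewrite !trmxD !trmxZ At Bt Ct. Qed.

Lemma parabola_cvg m n (A B C : 'M[R]_(m, n)) (t : R) :
  parabola A B C x @[x --> t] --> parabola A B C t.
Proof.
apply: cvgD; first by apply: cvgD; [exact: cvg_cst | apply: cvgZr_tmp; exact: cvg_id].
apply: cvgZr_tmp; apply: cvgM; first exact: cvg_cst.
exact: exprn_continuous.
Qed.

Lemma char_poly_horner n (S : 'M[R]_n) (x : R) :
  (char_poly S).[x] = \det (x%:M - S).
Proof.
rewrite -horner_evalE -det_map_mx; congr (\det _).
apply/matrixP => i j; rewrite !mxE /= /horner_eval !hornerE.
by case: eqP => _; rewrite ?mulr1n ?mulr0n hornerE.
Qed.

(** The polynomial is the characteristic polynomial of A + t B + t^2/2 C evaluated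
    at a + t b + t^2/2 c, that is, a determinant of polynomials in t. *)
Lemma parabola_contact_poly n (A B C : 'M[R]_n) (a b c : R) :
  A^T = A -> B^T = B -> C^T = C ->
  exists p : {poly R}, forall t, p.[t] =
    \prod_(i < n) (a + t * b + (2^-1 * t ^+ 2) * c - spectrum (parabola A B C t) 0 i).
Proof.
move=> At Bt Ct; pose P := map_mx (@polyC R).
pose q : {poly R} := 2^-1%:P * 'X^2.
exists (\det ((a%:P + 'X * b%:P + q * c%:P)%:M - (P _ _ A + 'X *: P _ _ B + q *: P _ _ C))).
move=> t; have [_ chE] := spectrum_is_spectrum (parabola_sym t At Bt Ct).
have -> : \prod_(i < n) (a + t * b + (2^-1 * t ^+ 2) * c - spectrum (parabola A B C t) 0 i)
    = (char_poly (parabola A B C t)).[a + t * b + (2^-1 * t ^+ 2) * c].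
  by rewrite chE horner_prod; apply: eq_bigr => i _; rewrite !hornerE.
rewrite char_poly_horner -horner_evalE -det_map_mx; congr (\det _).
apply/matrixP => i j; rewrite !mxE /= /horner_eval /q !hornerE.
by case: eqP => _; rewrite ?mulr1n ?mulr0n !hornerE.
Qed.

(** Boundedness of the quotient comes from [spectrum_line] and Weyl's inequality.
    The exceptional levels c are those for which the parabola a + t b + t^2/2 c is
    an eigenvalue for every t; reading this at t = 1 leaves at most n of them. *)
Lemma spectrum_parabola_cvg n (A B : 'M[R]_n) : A^T = A -> B^T = B ->
  exists b : 'rV[R]_n, forall C : 'M[R]_n, C^T = C -> forall i,
    cvg ((spectrum (parabola A B C t) 0 i - (spectrum A 0 i + t * b 0 i))
      / (2^-1 * t ^+ 2) @[t --> 0^'+]).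
Proof.
move=> At Bt; have [b [k bk]] := spectrum_line At Bt.
exists b => C Ct i; pose a := spectrum A 0 i; pose l t := spectrum (parabola A B C t) 0 i.
have q0 (t : R) : 0 < t -> 0 < 2^-1 * t ^+ 2 by move=> t0; rewrite mulr_gt0 ?exprn_gt0.
have lc t : l x @[x --> t] --> l t.
  apply: spectrum_cvg; last exact: parabola_cvg.
    by move=> x; apply: parabola_sym.
  exact: parabola_sym.
(* 2 k bounds the contribution of the line, the other term that of C. *)
apply: (@cvg_of_eventual_sign R _ (2 * k + n%:R ^+ 2 * `|C|)
  [seq (spectrum (parabola A B C 1) 0 j - a - b 0 i) * 2 | j <- enum 'I_n]).
  near=> t.
  have t0 : 0 < t by near: t; exact: nbhs_right_gt.
  have h1 : `|spectrum (A + t *: B) 0 i - (a + t * b 0 i)| <= k * t ^+ 2.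
    by near: t; apply: filterS bk.
  have ABt : (A + t *: B)^T = A + t *: B by rewrite trmxD trmxZ At Bt.
  have h2 := spectrum_lipschitz i (parabola_sym t At Bt Ct) ABt.
  rewrite normrM normfV (gtr0_norm (q0 t t0)) ler_pdivrMr ?q0 //.
  have hC : `|parabola A B C t - (A + t *: B)| = 2^-1 * t ^+ 2 * `|C|.
    by rewrite /parabola addrAC subrr add0r normrZ (gtr0_norm (q0 t t0)).
  rewrite hC in h2.
  have -> : (2 * k + n%:R ^+ 2 * `|C|) * (2^-1 * t ^+ 2) =
      n%:R ^+ 2 * (2^-1 * t ^+ 2 * `|C|) + k * t ^+ 2 by field.
  rewrite -[X in `|X - _|](subrK (spectrum (A + t *: B) 0 i)) -addrA.
  exact: le_trans (ler_normD _ _) (lerD h2 h1).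
move=> c cbad; have [p pE] := parabola_contact_poly a (b 0 i) c At Bt Ct.
have p0 : p != 0.
  apply: contra cbad => /eqP p0; have /esym/eqP := pE 1; rewrite p0 horner0.
  rewrite prodf_seq_eq0 => /hasP[j _ /=]; rewrite subr_eq0 => /eqP jE.
  apply/mapP; exists j; first by rewrite mem_enum.
  by rewrite -jE; field.
pose h t := l t - (a + t * b 0 i + (2^-1 * t ^+ 2) * c).
have hc : continuous h.
  move=> t; apply: cvgB; first exact: lc.
  apply: cvgD.
    by apply: cvgD; [exact: cvg_cst | apply: cvgM; [exact: cvg_id | exact: cvg_cst]].
  apply: cvgM; last exact: cvg_cst.
  by apply: cvgM; [exact: cvg_cst | exact: exprn_continuous].
have hn : \forall t \near 0^'+, h t != 0.
  apply: filterS (near0_horner_neq0 p0) => t; apply: contra => /eqP ht.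
  rewrite pE prodf_seq_eq0; apply/hasP; exists i => /=; first exact: mem_index_enum.
  by rewrite -oppr_eq0 opprB -/(l t) -/(h t) ht.
have [hs|hs] := near0_sign hc hn; [left|right]; near=> t.
  have t0 : 0 < t by near: t; exact: nbhs_right_gt.
  rewrite ltr_pdivrMr ?q0 // -/(l t) -/a.
  have : h t < 0 by near: t.
  by rewrite /h; lra.
have t0 : 0 < t by near: t; exact: nbhs_right_gt.
rewrite ltr_pdivlMr ?q0 // -/(l t) -/a.
have : 0 < h t by near: t.
by rewrite /h; lra.
Unshelve. all: by end_near. Qed.

End SpectrumAlongParabola.

(** * Singular values as eigenvalues *)

Section JordanWielandt.
Variable R : realType.

(** Linear in X, unlike X^T X: perturbing X along a parabola perturbs this matrix
    along a parabola, and no square root is taken at vanishing singular values. *)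
Definition jordan_wielandt m n (X : 'M[R]_(m, n)) : 'M[R]_(n + m) :=
  block_mx 0 X^T X 0.

Lemma jordan_wielandt_sym m n (X : 'M[R]_(m, n)) :
  (jordan_wielandt X)^T = jordan_wielandt X.
Proof. by rewrite tr_block_mx !trmx0 trmxK. Qed.

Lemma jordan_wielandtB m n (X Y : 'M[R]_(m, n)) :
  jordan_wielandt X - jordan_wielandt Y = jordan_wielandt (X - Y).
Proof.
by rewrite /jordan_wielandt opp_block_mx add_block_mx trmxB !oppr0 !addr0.
Qed.

Lemma jordan_wielandt_parabola m n (X H W : 'M[R]_(m, n)) t :
  jordan_wielandt (parabola X H W t) =
  parabola (jordan_wielandt X) (jordan_wielandt H) (jordan_wielandt W) t.
Proof.
rewrite /parabola /jordan_wielandt !scale_block_mx !add_block_mx !trmxD !trmxZ.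
by rewrite !scaler0 !addr0.
Qed.

Lemma jordan_wielandt_norm m n (X : 'M[R]_(m, n)) : `|jordan_wielandt X| <= `|X|.
Proof.
apply/mx_norm_le => // i j.
case: (split_ordP i) => i' ->; case: (split_ordP j) => j' ->.
- by rewrite block_mxEul mxE normr0.
- by rewrite block_mxEur mxE mx_entry_le.
- by rewrite block_mxEdl mx_entry_le.
- by rewrite block_mxEdr mxE normr0.
Qed.

(** Block elimination.  Multiplying x - J on the left by the block matrix with rows
    x, X^T and 0, 1 clears the upper right corner and leaves x^2 - X^T X and x on
    the diagonal. *)
Lemma char_poly_jordan_wielandt m n (X : 'M[R]_(m, n)) :
  'X^n * char_poly (jordan_wielandt X) = 'X^m * (char_poly (X^T *m X) \Po 'X^2).
Proof.
pose P p q : 'M[R]_(p, q) -> 'M[{poly R}]_(p, q) := map_mx (@polyC R).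
have -> : char_poly (X^T *m X) \Po 'X^2 = \det ('X^2%:M - P _ _ (X^T *m X)).
  rewrite /char_poly -[LHS]/(comp_poly 'X^2 _) -det_map_mx; congr (\det _).
  apply/matrixP => i j; rewrite !mxE /= comp_polyB comp_polyC.
  by case: eqP => _; rewrite ?mulr1n ?mulr0n ?comp_polyX ?comp_poly0.
have LE : char_poly_mx (jordan_wielandt X) =
    block_mx 'X%:M (- P _ _ X^T) (- P _ _ X) 'X%:M.
  rewrite /char_poly_mx scalar_mx_block map_block_mx opp_block_mx add_block_mx.
  by rewrite !map_mx0 !oppr0 !addr0 !add0r.
have <- : \det (block_mx ('X%:M : 'M[{poly R}]_n) (P _ _ X^T) 0 (1%:M : 'M[{poly R}]_m)) = 'X^n.
  by rewrite det_ublock det_scalar det1 mulr1.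
rewrite /char_poly -det_mulmx LE mulmx_block !mul0mx !mul1mx !add0r.
have -> : 'X%:M *m - P _ _ X^T + P _ _ X^T *m 'X%:M = 0.
  by rewrite mulmxN mul_scalar_mx mul_mx_scalar addNr.
by rewrite det_lblock det_scalar mulrC mulmxN -map_mxM -scalar_mxM.
Qed.

Lemma nonincreasing_row_mx p q (u : 'rV[R]_p) (v : 'rV[R]_q) :
  nonincreasing u -> nonincreasing v -> (forall i j, v 0 j <= u 0 i) ->
  nonincreasing (row_mx u v).
Proof.
move=> ui vi uv i j.
case: (split_ordP i) => i' ->; case: (split_ordP j) => j' ->;
  rewrite ?row_mxEl ?row_mxEr /= => ij //.
- exact: ui.
- by have := ltn_ord j'; rewrite ltnNge (leq_trans _ ij) ?leq_addr.
- by apply: vi; move: ij; rewrite leq_add2l.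
Qed.

(** With m = k + n, the eigenvalues are the singular values, k zeros, and the
    opposites of the singular values in reverse order. *)
Lemma spectrum_jordan_wielandt m n (X : 'M[R]_(m, n)) i : (n <= m)%N ->
  spectrum (jordan_wielandt X) 0 (lshift m i) = sigma X 0 i.
Proof.
move=> nm; have [_ [_ [_ _ [s0 si sE] _]]] := svd nm X.
move: X s0 si sE; rewrite -(subnK nm); move: (m - n)%N => k X s0 si sE.
set s := sigma X in s0 si sE *.
pose d := row_mx s (row_mx (0 : 'rV[R]_k) (\row_i - s 0 (rev_ord i))).
suff -> : spectrum (jordan_wielandt X) = d by rewrite row_mxEl.
apply: spectrumE; split.
  apply: nonincreasing_row_mx => //.
    apply: nonincreasing_row_mx.
    - by move=> a b _; rewrite !mxE.
    - by move=> a b ab; rewrite !mxE lerN2; apply: si; rewrite /= leq_sub2l.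
    - by move=> a b; rewrite !mxE oppr_le0.
  move=> a b; case: (split_ordP b) => b' ->; rewrite ?row_mxEl ?row_mxEr mxE //.
  by rewrite (le_trans _ (s0 a)) // oppr_le0.
have Xn0 : 'X^n != 0 :> {poly R} by rewrite expf_neq0 // polyX_eq0.
apply: (mulfI Xn0); rewrite char_poly_jordan_wielandt sE.
rewrite rmorph_prod /= !big_split_ord /=.
under [X in _ = _ * (X * _)]eq_bigr do rewrite row_mxEl.
under [X in _ = _ * (_ * (X * _))]eq_bigr do rewrite row_mxEr row_mxEl mxE subr0.
under [X in _ = _ * (_ * (_ * X))]eq_bigr do rewrite row_mxEr row_mxEr mxE polyCN opprK.
rewrite prodr_const card_ord [X in _ = _ * (_ * (_ * X))](reindex_inj rev_ord_inj) /=.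
under [X in _ = _ * (_ * (_ * X))]eq_bigr do rewrite rev_ordK.
rewrite exprD.
have -> : \prod_(i < n) (('X - (s 0 i ^+ 2)%:P) \Po 'X^2) =
    \prod_(i < n) ('X - (s 0 i)%:P) * \prod_(i < n) ('X + (s 0 i)%:P) :> {poly R}.
  rewrite -big_split /=; apply: eq_bigr => j _.
  by rewrite comp_polyB comp_polyX comp_polyC polyC_exp; ring.
ring.
Qed.

End JordanWielandt.

(** * Parabolic expansion of the singular values *)

Section SigmaExpansion.
Variables (R : realType) (m n : nat).
Hypothesis le_nm : (n <= m)%N.
Implicit Types X Y H W : 'M[R]_(m, n).

Lemma sigma_lipschitz : exists2 c : R, 0 <= c &
  forall X Y, `|sigma X - sigma Y| <= c * `|X - Y|.
Proof.
exists ((n + m)%:R ^+ 2); first exact: exprn_ge0.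
move=> X Y; apply/mx_norm_le => [|i j]; first by rewrite mulr_ge0 ?exprn_ge0.
rewrite ord1 !mxE -!spectrum_jordan_wielandt //.
apply: le_trans (spectrum_lipschitz _ (jordan_wielandt_sym X) (jordan_wielandt_sym Y)) _.
by rewrite ler_wpM2l ?exprn_ge0 // jordan_wielandtB jordan_wielandt_norm.
Qed.

(** The slope b of the eigenvalue expansion does not depend on the second-order
    term, so it is identified with sigma' by taking that term to be 0. *)
Lemma sigma_second_derivative X H W i :
  (sigma (parabola X H W t) 0 i - sigma X 0 i - t * sigma' X H 0 i)
    / (2^-1 * t ^+ 2) @[t --> 0^'+] --> sigma'' X H W 0 i.
Proof.
have Jt := @jordan_wielandt_sym R m n.
have [b bP] := spectrum_parabola_cvg (Jt X) (Jt H).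
have sE V t : sigma (parabola X H V t) 0 i = spectrum (parabola (jordan_wielandt X)
    (jordan_wielandt H) (jordan_wielandt V) t) 0 (lshift m i).
  by rewrite -jordan_wielandt_parabola spectrum_jordan_wielandt.
have {}bP V := bP _ (Jt V) (lshift m i).
rewrite spectrum_jordan_wielandt // in bP.
have {}bP V : cvg ((sigma (parabola X H V t) 0 i
    - (sigma X 0 i + t * b 0 (lshift m i))) / (2^-1 * t ^+ 2) @[t --> 0^'+]).
  by under eq_fun do rewrite sE; exact: bP.
have s'E : sigma' X H 0 i = b 0 (lshift m i).
  rewrite mxE; apply/cvg_lim => //.
  have := bP 0; set g := (fun t => _ / _) => gcvg.
  have : b 0 (lshift m i) + (2^-1 * t) * g t @[t --> 0^'+] -->
         b 0 (lshift m i) + (2^-1 * 0) * lim (g t @[t --> 0^'+]).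
    apply: cvgD; first exact: cvg_cst.
    apply: cvgM => //; apply: cvgM; first exact: cvg_cst.
    by apply: cvg_at_right_filter; exact: cvg_id.
  rewrite mulr0 mul0r addr0; apply: cvg_trans; apply: near_eq_cvg; near=> t.
  have t0 : t != 0 by rewrite gt_eqF.
  rewrite /g /parabola scaler0 addr0; move: (sigma _ 0 i) (sigma X 0 i) (b 0 _).
  by move=> p q r; field.
rewrite [sigma'' _ _ _ _ _]mxE s'E.
have -> : (fun t => (sigma (parabola X H W t) 0 i - sigma X 0 i
      - t * b 0 (lshift m i)) / (2^-1 * t ^+ 2)) =
    (fun t => (sigma (parabola X H W t) 0 i
      - (sigma X 0 i + t * b 0 (lshift m i))) / (2^-1 * t ^+ 2)).
  by apply/funext => t; rewrite opprD addrA.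
have := bP W; under eq_fun do rewrite opprD addrA; by [].
Unshelve. all: by end_near. Qed.

End SigmaExpansion.

(** * Convergence of matrices and second-order quotients *)

Section MatrixConvergence.
Variable R : realType.

Lemma cvg_mx (T : Type) (F : set_system T) {FF : Filter F} m n
    (f : T -> 'M[R]_(m, n)) (A : 'M[R]_(m, n)) :
  (forall i j, f x i j @[x --> F] --> A i j) -> f x @[x --> F] --> A.
Proof.
move=> fA; apply/cvgrPdist_le => e e0.
suff : \forall x \near F, forall i j, `|A i j - f x i j| <= e.
  apply: filterS => x h; apply/mx_norm_le => [|i j]; first exact: ltW.
  by rewrite !mxE h.
apply: filter_forall => i; apply: filter_forall => j.
by have /cvgrPdist_le/(_ _ e0) := fA i j.
Qed.

Lemma cvg_to_right0 (T : Type) (F : set_system T) {FF : Filter F} (t : T -> R) :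
  (forall x, 0 < t x) -> t x @[x --> F] --> (0 : R) -> t x @[x --> F] --> 0^'+.
Proof.
move=> t0 tF P /near0_right_ex[e e0 eP]; move/cvgrPdist_lt : tF => /(_ _ e0).
by apply: filterS => x; rewrite sub0r normrN gtr0_norm // => te; apply: eP; rewrite t0.
Qed.

(** Bolzano and Weierstrass, through the compactness of balls of row vectors.  The
    indices phi are not asked to increase: phi k >= k is what keeps the limits along
    the original sequence. *)
Lemma bounded_mx_subsequence m n (A : nat -> 'M[R]_(m, n)) (c : R) :
  (forall k, `|A k| <= c) -> exists (B : 'M[R]_(m, n)) (phi : nat -> nat),
    (forall k, (k <= phi k)%N) /\ A (phi k) @[k --> \oo] --> B.
Proof.
move=> Ac; pose v k := mxvec (A k).
have vE k i j : v k 0 (mxvec_index i j) = A k i j by rewrite mxvecE.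
pose K := [set u : 'rV[R]_(m * n) | `|u| <= c].
have Kc : compact K.
  apply: bounded_closed_compact.
    by exists c; split; [exact: num_real | move=> x cx u /= /le_trans; apply; exact: ltW].
  have -> : K = (fun u => `|u|) @^-1` [set x | x <= c] by [].
  by apply: closed_comp; [move=> u _; exact: norm_continuous | exact: closed_le].
have Kv k : K (v k).
  apply/mx_norm_le => [|i j]; first exact: le_trans (Ac 0%N).
  rewrite ord1; case/mxvec_indexP: j => p q; rewrite vE.
  exact: le_trans (mx_entry_le _ _ _) (Ac k).
have [u [_ ucl]] : K `&` cluster (v k @[k --> \oo]) !=set0.
  by apply: (Kc (v k @[k --> \oo])); exists 0%N => // k _; exact: Kv.
pose B := vec_mx u.
(* A term of index at least k that is within 1 / (k + 1) of the cluster point. *)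
have near_k k : exists l, (k <= l)%N /\ `|B - A l| <= k.+1%:R^-1.
  have e0 : 0 < k.+1%:R^-1 :> R by rewrite invr_gt0.
  have [x [[l /= kl <-] ux]] := ucl (v @` [set l | (k <= l)%N]) (ball u k.+1%:R^-1)
    (ex_intro2 _ _ k I (fun l kl => ex_intro2 _ _ l kl erefl)) (nbhsx_ballx _ _ e0).
  exists l; split=> //; apply/mx_norm_le => [|i j]; first exact: ltW.
  have -> : (B - A l) i j = (u - v l) 0 (mxvec_index i j) by rewrite !mxE mxvecE.
  apply: le_trans (mx_entry_le _ _ _) _.
  by move: ux; rewrite -ball_normE /= => /ltW.
have [phi phiP] := choice near_k.
exists B, phi; split=> [k|]; first by have [] := phiP k.
apply/cvgrPdist_le => e e0; near=> k.
have [_ h] := phiP k; apply: le_trans h _.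
by apply: ltW; near: k; exact: near_infty_natSinv_lt (PosNum e0).
Unshelve. all: by end_near. Qed.

End MatrixConvergence.

Section SecondOrderQuotient.
Variables (R : realType) (V : normedModType R).
Implicit Types x w z u : V.

(** The u for which z = x + t w + t^2/2 u, see [quotient2K]. *)
Definition quotient2 x w z (t : R) : V := (2^-1 * t ^+ 2)^-1 *: (z - x - t *: w).

Lemma quotient2K x w z t : 0 < t ->
  x + t *: w + (2^-1 * t ^+ 2) *: quotient2 x w z t = z.
Proof.
move=> t0; rewrite scalerA mulfV ?scale1r; last first.
  by rewrite mulf_neq0 ?invr_eq0 ?expf_neq0 ?gt_eqF.
by rewrite -(addrA z) -opprD addrCA subrr addr0.
Qed.

Lemma quotient2_parabola x w u t : 0 < t ->
  quotient2 x w (x + t *: w + (2^-1 * t ^+ 2) *: u) t = u.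
Proof.
move=> t0; rewrite /quotient2 -(addrA _ (- x)) -opprD addrAC subrr add0r scalerA.
by rewrite mulVf ?scale1r // mulf_neq0 ?invr_eq0 ?expf_neq0 ?gt_eqF.
Qed.

Lemma quotient2_dist x w z z' t : 0 < t ->
  `|quotient2 x w z t - quotient2 x w z' t| = (2^-1 * t ^+ 2)^-1 * `|z - z'|.
Proof.
move=> t0; rewrite -scalerBr normrZ gtr0_norm ?invr_gt0 ?mulr_gt0 ?exprn_gt0 //.
by congr (_ * `|_|); do 2!rewrite opprD addrACA subrr addr0.
Qed.

Lemma quotient2_first_derivative x w u (xi : R -> V) :
  quotient2 x w (xi t) t @[t --> 0^'+] --> u ->
  t^-1 *: (xi t - x) @[t --> 0^'+] --> w.
Proof.
move=> xiu.
have : w + (2^-1 * t) *: quotient2 x w (xi t) t @[t --> 0^'+] --> w + (2^-1 * 0 : R) *: u.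
  apply: cvgD; first exact: cvg_cst.
  apply: cvgZ => //; apply: cvgM; first exact: cvg_cst.
  by apply: cvg_at_right_filter; exact: cvg_id.
rewrite mulr0 scale0r addr0; apply: cvg_trans; apply: near_eq_cvg; near=> t.
have t0 : t != 0 by rewrite gt_eqF.
rewrite /quotient2 scalerA.
have -> : 2^-1 * t * (2^-1 * t ^+ 2)^-1 = t^-1 by field.
by rewrite scalerBr scalerA mulVf // scale1r addrC subrK.
Unshelve. all: by end_near. Qed.

End SecondOrderQuotient.

(** * Lifting from singular values to matrices *)

Section Lift.
Variables (R : realType) (m n : nat).
Hypothesis le_nm : (n <= m)%N.
Variable Gamma : set 'M[R]_(m, n).
Hypothesis Gamma_inv : orthogonally_invariant Gamma.
Implicit Types (X H W Z : 'M[R]_(m, n)) (x y : 'rV[R]_n).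

Lemma invariant_conj X (U : 'M[R]_m) (V : 'M[R]_n) :
  orthogonal_mx U -> orthogonal_mx V -> Gamma X -> Gamma (U *m X *m V^T).
Proof.
by move=> Uo Vo; rewrite -[U in U *m X]trmxK; apply: Gamma_inv; rewrite trmxK.
Qed.

Lemma sigma_diag_set X : Gamma X -> diag_set Gamma (sigma X).
Proof.
have [U [V [Uo Vo _ UX]]] := svd le_nm X.
by rewrite /diag_set /= -UX; apply: invariant_conj.
Qed.

Lemma rect_diag_mxB x y :
  rect_diag_mx x - rect_diag_mx y = rect_diag_mx (x - y) :> 'M[R]_(m, n).
Proof. by apply/matrixP => i j; rewrite !mxE; case: eqP => _; rewrite ?subr0. Qed.

Lemma rect_diag_mx_norm x : `|rect_diag_mx x : 'M[R]_(m, n)| <= `|x|.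
Proof.
apply/mx_norm_le => // i j; rewrite mxE; case: eqP => _; last by rewrite normr0.
exact: mx_entry_le.
Qed.

(** For a decomposition Z = U^T diag(sigma Z) V, chosen once for each Z, the lift of
    y is U^T diag(y) V; orthogonal factors do not increase norms by more than a
    constant. *)
Lemma spectral_lift : exists (lift : 'M[R]_(m, n) -> 'rV[R]_n -> 'M[R]_(m, n)) (c : R),
  [/\ 0 <= c, forall Z y, `|lift Z y - Z| <= c * `|y - sigma Z|
    & forall Z y, diag_set Gamma y -> Gamma (lift Z y)].
Proof.
have /choice[UV UVP] : forall Z, exists p : 'M[R]_m * 'M[R]_n,
    [/\ orthogonal_mx p.1, orthogonal_mx p.2
      & p.1 *m Z *m p.2^T = rect_diag_mx (sigma Z)].
  by move=> Z; have [U [V [Uo Vo _ UZ]]] := svd le_nm Z; exists (U, V).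
exists (fun Z y => (UV Z).1^T *m rect_diag_mx y *m (UV Z).2), (n%:R * m%:R).
split=> [|Z y|Z y yD]; first by rewrite mulr_ge0.
- have [Uo Vo UZ] := UVP Z; set U := (UV Z).1 in Uo UZ *; set V := (UV Z).2 in Vo UZ *.
  have {1}-> : Z = U^T *m rect_diag_mx (sigma Z) *m V.
    rewrite -UZ !mulmxA (mulmx1C Uo) mul1mx -mulmxA.
    by rewrite (mulmx1C Vo) mulmx1.
  rewrite -mulmxBl -mulmxBr rect_diag_mxB.
  apply: le_trans (mx_norm_mulmx _ _) _; rewrite -mulrA ler_wpM2l //.
  apply: le_trans (ler_piMr _ (orthogonal_mx_norm Vo)) _ => //.
  apply: le_trans (mx_norm_mulmx _ _) _; rewrite ler_wpM2l //.
  apply: le_trans (ler_piMl _ _) (rect_diag_mx_norm _) => //.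
  by rewrite mx_norm_tr orthogonal_mx_norm.
have [Uo Vo _] := UVP Z; rewrite -[(UV Z).2]trmxK.
by apply: invariant_conj => //; apply: orthogonal_mx_tr.
Qed.

Lemma sigma_quotient2_cvg X H W :
  quotient2 (sigma X) (sigma' X H) (sigma (parabola X H W t)) t @[t --> 0^'+]
  --> sigma'' X H W.
Proof.
apply: cvg_mx => i j; rewrite ord1.
have := sigma_second_derivative le_nm (X := X) (H := H) (W := W) (i := j).
apply: cvg_trans; apply: near_eq_cvg; near=> t.
by rewrite !mxE mulrC.
Unshelve. all: by end_near. Qed.

End Lift.

(** * Transfer of second-order tangents and arcs *)

Section Transfer.
Variables (R : realType) (m n : nat).
Hypothesis le_nm : (n <= m)%N.
Variable Gamma : set 'M[R]_(m, n).
Hypothesis Gamma_inv : orthogonally_invariant Gamma.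
Variables X H : 'M[R]_(m, n).
Let Delta : set 'rV[R]_n := diag_set Gamma.
Let x : 'rV[R]_n := sigma X.
Let w : 'rV[R]_n := sigma' X H.

(** The expansion holds for the fixed W; passing to W_k costs, by the Lipschitz
    bound, at most a constant times |W - W_k| in the second-order quotient. *)
Lemma second_order_tangent_sigma W : second_order_tangent_set Gamma X H W ->
  second_order_tangent_set Delta x w (sigma'' X H W).
Proof.
move=> [t [W_ [t0 tcv Wcv ZG]]].
have [c c0 lip] := @sigma_lipschitz R _ _ le_nm.
pose u k := quotient2 x w (sigma (parabola X H (W_ k) (t k))) (t k).
exists t, u; split=> // [|k]; last first.
  by rewrite quotient2K //; apply: (sigma_diag_set le_nm Gamma_inv); exact: ZG.
have tr : t k @[k --> \oo] --> 0^'+ by apply: cvg_to_right0.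
pose v k := quotient2 x w (sigma (parabola X H W (t k))) (t k).
have vcv : v k @[k --> \oo] --> sigma'' X H W.
  exact: cvg_comp tr (sigma_quotient2_cvg le_nm (X := X) (H := H) (W := W)).
have uv k : `|v k - u k| <= c * `|W - W_ k|.
  rewrite quotient2_dist // mulrC ler_pdivrMr ?mulr_gt0 ?exprn_gt0 //.
  apply: le_trans (lip _ _) _; rewrite -mulrA ler_wpM2l //.
  have -> : parabola X H W (t k) - parabola X H (W_ k) (t k) =
      (2^-1 * t k ^+ 2) *: (W - W_ k).
    by rewrite /parabola opprD addrACA subrr add0r scalerBr.
  by rewrite normrZ gtr0_norm ?mulr_gt0 ?exprn_gt0 // mulrC.
have d0 : v k - u k @[k --> \oo] --> (0 : 'rV[R]_n).
  apply/cvgrPdist_lt => e e0; have e1 : 0 < e / (c + 1) by rewrite divr_gt0 ?ltr_wpDl.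
  move/cvgrPdist_lt : Wcv => /(_ _ e1); apply: filterS => k.
  rewrite ltr_pdivlMr ?ltr_wpDl // sub0r normrN => h; apply: le_lt_trans (uv k) _.
  by have := normr_ge0 (W - W_ k); nra.
have -> : u = (fun k => v k - (v k - u k)) by apply/funext => k; rewrite subKr.
by rewrite -[sigma'' X H W]subr0; exact: cvgB.
Qed.

(** The distance estimate of a lift, divided by t^2/2. *)
Lemma lift_quotient2_le (lift : 'M[R]_(m, n) -> 'rV[R]_n -> 'M[R]_(m, n)) (c t : R)
    (y : 'rV[R]_n) W :
  (forall Z y, `|lift Z y - Z| <= c * `|y - sigma Z|) -> 0 < t ->
  `|quotient2 X H (lift (parabola X H W t) y) t - W| <=
  c * `|quotient2 x w y t - quotient2 x w (sigma (parabola X H W t)) t|.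
Proof.
move=> liftc t0; rewrite -[X in _ - X](quotient2_parabola X H W t0).
have q0 : 0 <= (2^-1 * t ^+ 2)^-1 by rewrite invr_ge0 mulr_ge0 // exprn_ge0 // ltW.
by rewrite !quotient2_dist // [leRHS]mulrCA ler_wpM2l // liftc.
Qed.

(** Stated for a general filter: it serves for sequences t_k as well as for arcs. *)
Lemma lift_quotient2_cvg (T : Type) (F : set_system T) {FF : Filter F}
    (t : T -> R) (lift : 'M[R]_(m, n) -> 'rV[R]_n -> 'M[R]_(m, n)) (c : R) 
    (y : T -> 'rV[R]_n) W : 0 <= c ->
  (forall Z y, `|lift Z y - Z| <= c * `|y - sigma Z|) ->
  t s @[s --> F] --> 0^'+ ->
  quotient2 x w (y s) (t s) @[s --> F] --> sigma'' X H W ->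
  quotient2 X H (lift (parabola X H W (t s)) (y s)) (t s) @[s --> F] --> W.
Proof.
move=> c0 liftc tF ycv.
have scv : quotient2 x w (sigma (parabola X H W (t s))) (t s) @[s --> F]
    --> sigma'' X H W.
  exact: cvg_comp tF (sigma_quotient2_cvg le_nm (X := X) (H := H) (W := W)).
have dcv : quotient2 x w (y s) (t s)
    - quotient2 x w (sigma (parabola X H W (t s))) (t s) @[s --> F] --> (0 : 'rV[R]_n).
  by rewrite -(subrr (sigma'' X H W)); exact: cvgB.
have tpos : \forall s \near F, 0 < t s.
  exact: (tF [set r | 0 < r] (nbhs_right_gt 0)).
apply/cvgrPdist_lt => e e0; have e1 : 0 < e / (c + 1) by rewrite divr_gt0 ?ltr_wpDl.
move/cvgrPdist_lt : dcv => /(_ _ e1) dcv.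
apply: filterS2 tpos dcv => s ts.
rewrite ltr_pdivlMr ?ltr_wpDl // sub0r normrN mulrDr mulr1 mulrC => h.
rewrite distrC; apply: le_lt_trans (lift_quotient2_le (y s) W liftc ts) _.
by apply: le_lt_trans h; rewrite lerDl.
Qed.

Lemma second_order_tangent_lift W :
  second_order_tangent_set Delta x w (sigma'' X H W) ->
  second_order_tangent_set Gamma X H W.
Proof.
move=> [t [u [t0 tcv ucv yD]]].
have [lift [c [c0 liftc liftG]]] := spectral_lift le_nm Gamma_inv.
pose y k := x + t k *: w + (2^-1 * t k ^+ 2) *: u k.
exists t, (fun k => quotient2 X H (lift (parabola X H W (t k)) (y k)) (t k)).
split=> // [|k]; last by rewrite quotient2K //; apply: liftG; apply: yD.
apply: (lift_quotient2_cvg c0 liftc); first exact: cvg_to_right0.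
have -> // : (fun k => quotient2 x w (y k) (t k)) = u.
by apply/funext => k; rewrite quotient2_parabola.
Qed.

(** A direction u of Delta need not be of the form sigma''(X;H,W) for a W known in
    advance.  Lifting the points of Delta over X + t_k H gives quotients W_k that
    are bounded by a multiple of |u_k - v_k|, with v_k the quotients of
    sigma(X + t_k H), and a cluster point of the W_k is a tangent. *)
Lemma second_order_tangent_nonempty :
  second_order_tangent_set Delta x w !=set0 ->
  second_order_tangent_set Gamma X H !=set0.
Proof.
move=> [u0 [t [u [t0 tcv ucv yD]]]].
have [lift [c [c0 liftc liftG]]] := spectral_lift le_nm Gamma_inv.
pose y k := x + t k *: w + (2^-1 * t k ^+ 2) *: u k.
pose Z k := parabola X H 0 (t k).
pose W k := quotient2 X H (lift (Z k) (y k)) (t k).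
pose v k := quotient2 x w (sigma (Z k)) (t k).
have vcv : v k @[k --> \oo] --> sigma'' X H 0.
  have tr : t k @[k --> \oo] --> 0^'+ by apply: cvg_to_right0.
  exact: cvg_comp tr (sigma_quotient2_cvg le_nm (X := X) (H := H) (W := 0)).
have Wle k : `|W k| <= c * `|u k - v k|.
  have := lift_quotient2_le (y k) 0 liftc (t0 k).
  by rewrite subr0 [quotient2 x w (y k) _]quotient2_parabola.
have /cvg_seq_bounded[M [_ uvM]] : cvg (u k - v k @[k --> \oo]).
  by apply: cvgP; apply: cvgB ucv vcv.
have Wbound k : `|W k| <= c * (M + 1).
  by apply: le_trans (Wle k) _; rewrite ler_wpM2l // uvM // ltrDl.
have [W0 [phi [phik Wphi]]] := bounded_mx_subsequence Wbound.
exists W0, (t \o phi), (W \o phi); split=> //=.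
- move/cvgrPdist_lt : tcv => tcv; apply/cvgrPdist_lt => e /tcv[N _ Ne].
  by exists N => // k /= Nk; apply: Ne => /=; apply: leq_trans Nk _.
- by move=> k; rewrite quotient2K //; apply: liftG; apply: yD.
Qed.

(** The lift at t = 0 is X itself because the arc starts at sigma X. *)
Lemma parabolic_arc_lift W (eps : R) (xi : R -> 'rV[R]_n) :
  0 < eps -> (forall t, 0 <= t <= eps -> Delta (xi t)) -> xi 0 = x ->
  quotient2 (xi 0) w (xi t) t @[t --> 0^'+] --> sigma'' X H W ->
  exists zeta : R -> 'M[R]_(m, n),
    [/\ forall t, 0 <= t <= eps -> Gamma (zeta t), zeta 0 = X
      & quotient2 (zeta 0) H (zeta t) t @[t --> 0^'+] --> W].
Proof.
move=> e0 xiD xi0; rewrite xi0 => xicv.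
have [lift [c [c0 liftc liftG]]] := spectral_lift le_nm Gamma_inv.
pose zeta t := lift (parabola X H W t) (xi t).
have zeta0 : zeta 0 = X.
  have P0 : parabola X H W 0 = X by rewrite /parabola expr0n mulr0 !scale0r !addr0.
  rewrite /zeta P0 xi0; apply/eqP; rewrite -subr_eq0 -normr_le0.
  by apply: le_trans (liftc X x) _; rewrite subrr normr0 mulr0.
exists zeta; split=> // [t te|]; first by apply: liftG; apply: xiD.
by rewrite zeta0; apply: (lift_quotient2_cvg c0 liftc) => //; apply: cvg_id.
Qed.

End Transfer.

Theorem proposition4p6 (R : realType) (m n : nat) (le_nm : (n <= m)%N)
    (Gamma : set 'M[R]_(m, n)) (Gamma_inv : orthogonally_invariant Gamma)
    (X H : 'M[R]_(m, n)) (GammaX : Gamma X)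
    (tanH : tangent_cone Gamma X H) :
  second_order_tangent_set Gamma X H =
    [set W : 'M[R]_(m, n) |
      second_order_tangent_set (diag_set Gamma)
        (sigma X) (sigma' X H) (sigma'' X H W)] /\
  (parabolically_derivable (diag_set Gamma) (sigma X) (sigma' X H) ->
   parabolically_derivable Gamma X H).
Proof.
split.
  apply/seteqP; split=> W /=.
    exact: second_order_tangent_sigma.
  exact: second_order_tangent_lift.
move=> [T2ne arcs]; split; first exact: second_order_tangent_nonempty.
move=> W /(second_order_tangent_sigma le_nm Gamma_inv) /arcs[eps [xi [e0 xiD xi0 _ xi2]]].
have [zeta [zetaG zeta0 zeta2]] := parabolic_arc_lift le_nm Gamma_inv e0 xiD xi0 xi2.
exists eps, zeta; split=> //.
by apply: quotient2_first_derivative zeta2.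
Qed.
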